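(* Let $c>0$ be a constant, let $q=\kappa n$, and let $\mu$ be the size of the rainbow matching produced by MODIFIED GREEDY on $G_{n,m}$, $m=cn/2$, whose edges are colored independently and uniformly at random from $[q]$. Then the following hold with high probability. (a) Let $N(\tau)$ be the solution of \[ N(\tau)=1-2\tau+ \int_0^\tau \exp\left\{ - \frac c\kappa N(\sigma)(N(\sigma)+\sigma+\kappa-1)\right\} d\sigma, \] and let $\tau_0 \in [0,1]$ be the solution to $N(\tau_0)=0$. Then $\mu \sim (1-\tau_0)n$. (b) If $\kappa \ge 1/2$ then \[ \mu \le \frac{c-1+e^{-c}}{2c-1+e^{-c}}\,n. \]
   Context: $G_{n,m}$ is the uniform random graph on vertex set $[n]$ with $m$ edges; here $m=cn/2$, and each edge is independently given a color chosen uniformly at random from $[q]$. A set of edges is rainbow if all its edges have distinct colors. MODIFIED GREEDY: start with $M=\emptyset$; while the current graph $G=(V,E)$ has an edge, choose a vertex $v\in V$ uniformly at random; if $v$ has no neighbors, delete $v$; otherwise choose a neighbor $u$ of $v$ uniformly at random, add $e=\{u,v\}$ to $M$, delete $u,v$ from $G$, and delete from $G$ all edges having the same color as $e$; output $M$. ''With high probability'' means with probability tending to $1$ as $n\to\infty$; $\sim$ denotes asymptotic equality as $n\to\infty$. *)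

(* Defs.v *)
From HB Require Import structures.
From mathcomp Require Import all_boot all_order all_algebra.
From mathcomp Require Import all_classical all_reals all_analysis.

Set Implicit Arguments.
Unset Strict Implicit.
Unset Printing Implicit Defensive.

Import Order.TTheory GRing.Theory Num.Theory.
Import numFieldNormedType.Exports.

Local Open Scope classical_set_scope.
Local Open Scope ring_scope.

(* Finite laws are represented by their probability mass functions. *)
Definition law (R : realType) (T : finType) : Type := T -> R.

Definition dret (R : realType) (T : finType) (x : T) : law R T :=
  fun y => (y == x)%:R.

Definition dbind (R : realType) (S T : finType)
    (p : law R S) (k : S -> law R T) : law R T :=
  fun y => \sum_(x : S) p x * k x y.

(* The zero function when [A] is empty. *)
Definition unif (R : realType) (T : finType) (A : {set T}) : law R T :=
  fun x => (x \in A)%:R / #|A|%:R.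

Definition Pr (R : realType) (T : finType) (p : law R T) (A : pred T) : R :=
  \sum_(x : T | A x) p x.

Definition whp (R : realType) (T : nat -> finType)
    (p : forall n, law R (T n)) (A : forall n, pred (T n)) : Prop :=
  (fun n : nat => Pr (p n) (A n)) @ \oo --> (1 : R).

Definition neighbors (n : nat) (E : {set {set 'I_n}}) (v : 'I_n) : {set 'I_n} :=
  [set u | [set u; v] \in E]%SET.

(* Law of the output of MODIFIED GREEDY started from the graph (V, E), with [M]
   the edges chosen so far.  Every round deletes a vertex, so [#|V|] units of
   [fuel] are enough to reach a graph with no edge. *)
Fixpoint modified_greedy (R : realType) (n q : nat)
    (col : {ffun {set 'I_n} -> 'I_q}) (fuel : nat)
    (V : {set 'I_n}) (E M : {set {set 'I_n}}) : law R {set {set 'I_n}} :=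
  if fuel is k.+1 then
    if E == finset.set0 then dret R M
    else dbind (unif R V) (fun v =>
      if neighbors E v == finset.set0 then
        modified_greedy R col k (V :\ v)%SET E M
      else dbind (unif R (neighbors E v)) (fun u =>
        let e := [set u; v]%SET in
        modified_greedy R col k (V :\: e)%SET
          [set f in E | [disjoint f & e] && (col f != col e)]%SET
          (e |: M)%SET))
  else dret R M.

Definition Gnm (R : realType) (n m : nat) : law R {set {set 'I_n}} :=
  unif R [set E : {set {set 'I_n}} |
            (#|E| == m) && [forall e in E, #|e| == 2%N]]%SET.
Arguments Gnm : clear implicits.

(* Every set of vertices receives an independent uniform color; only the colors
   of the edges of the graph are ever read. *)
Definition random_coloring (R : realType) (n q : nat) :
    law R {ffun {set 'I_n} -> 'I_q} :=
  unif R [set: {ffun {set 'I_n} -> 'I_q}]%SET.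
Arguments random_coloring : clear implicits.

Definition greedy_matching (R : realType) (n m q : nat) :
    law R {set {set 'I_n}} :=
  dbind (Gnm R n m) (fun E =>
    dbind (random_coloring R n q) (fun col =>
      modified_greedy R col n [set: 'I_n]%SET E finset.set0)).
Arguments greedy_matching : clear implicits.

(* Continuity excludes functions for which the integral is not meaningful and
   only has a default value. *)
Definition is_solution (R : realType) (c kappa : R) (N : R -> R) : Prop :=
  {within `[0, 1], continuous N} /\
  forall tau : R, 0 <= tau <= 1 ->
    N tau = 1 - 2 * tau +
      \int[lebesgue_measure]_(s in `[0, tau])
        expR (- (c / kappa * N s * (N s + s + kappa - 1))).

(* Main.v *)
(* Replace the uniform graph with [m] edges by the binomial random graph with the
   same density.  There the presence and the colour of a pair of surviving
   vertices are still unrevealed, so the number [j] of chosen edges is a Markov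
   chain: with [k - j] other survivors and [q - j] unused colours, the chosen
   vertex stays unmatched with probability [(1 - p (q - j) / q) ^ (k - j)].  A
   Gronwall estimate for the second moment shows that the chain stays within
   [O(sqrt n)] of [n] times the solution of
   [J' = 1 - exp (- (c / kappa) (1 - t - J) (kappa - J))], where
   [J t = 1 - t - N t], so a deviation of order [n] has probability [O(1 / n)].
   The binomial graph has exactly [m] edges with probability of order at least
   [1 / n ^ (1 / 2)] for the mode of a binomial law, hence the deviation is still
   unlikely in the uniform graph.

   The bound (b) follows from a strict lower bound on the root [tau0], obtained
   by integrating a differential inequality. *)

Require Import Defs.
From HB Require Import structures.
From mathcomp Require Import all_boot all_order all_algebra.
From mathcomp Require Import ring lra zify.
From mathcomp Require Import all_classical all_reals all_analysis.

Set Implicit Arguments.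
Unset Strict Implicit.
Unset Printing Implicit Defensive.

Import Order.TTheory GRing.Theory Num.Theory.
Import numFieldNormedType.Exports.

Local Open Scope classical_set_scope.
Local Open Scope ring_scope.

(** The second moment is propagated backwards, by the number of rounds left: this follows the
    recursion on [fuel], so only means of functions of the final size occur and no path of the chain
    is ever described. The obstacle is the end of the process. The chain is absorbed at a random
    round, when the vertices run out, whereas [N] may become negative after [tau0], where the
    equation no longer describes anything. Two devices agree on this. The drift is truncated at 0,
    just as natural subtraction truncates [k - j] and [q - j]; and the limiting curve is frozen at
    [tau0], from where on the truncated drift along it vanishes. In (b) the bound on the root must
    be strict because the gap between [1 - tau0] and the claimed constant is the deviation that is
    allowed. *)

(** * Calculus on [0, 1] and a barrier principle *)

Lemma within_continuous_expR_quadratic (R : realType) (a k : R) (f g : R -> R)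
    (A : set R) :
  {within A, continuous f} -> {within A, continuous g} ->
  {within A, continuous (fun s : R => expR (- (a * f s * (g s + s + k - 1))))}.
Proof.
move=> fc gc.
apply: (@within_continuous_comp _ _ _ A _ expR); first by move=> x _; exact: continuous_expR.
have idc : {within A, continuous (fun s : R => s)}.
  by apply: continuous_subspaceT => x; exact: cvg_id.
move=> x; apply: cvgN; apply: cvgM; first by apply: cvgMr; exact: fc.
apply: cvgD; last exact: cvg_cst.
apply: cvgD; last exact: cvg_cst.
by apply: cvgD; [exact: gc | exact: idc].
Qed.

Lemma integral_equation_is_derive (R : realType) (N G : R -> R) (x : R) :
  {within `[0, 1], continuous G} ->
  (forall t : R, 0 <= t <= 1 ->
     N t = 1 - 2 * t + \int[lebesgue_measure]_(s in `[0, t]) G s) ->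
  x \in `]0, 1[%R -> is_derive x 1 N (- 2 + G x).
Proof.
move=> Gc Neq x01; have /andP[x0 x1] : (0 < x < 1) by move: x01; rewrite in_itv.
have [dF F'] := @continuous_FTC1_closed R G 0 x 1 x1
  (continuous_compact_integrable (@segment_compact _ _ _) Gc) x0
  (within_continuous_continuous ltr01 Gc x01).
apply: (@near_eq_is_derive _ _ _
   (fun y : R => (- 2) * y + 1 + \int[lebesgue_measure]_(t in `[0, y]) G t)).
  near=> y; rewrite Neq; first by ring.
  apply/andP; split; apply: ltW; near: y.
    exact: lt_nbhsr.
  exact: lt_nbhsl.
have dG := DeriveDef dF erefl; rewrite -derive1E F' in dG.
have dA : is_derive x 1 (fun y : R => -2 * y + 1) (-2).
  by apply: is_derive_eq; rewrite addr0 [_ *: _]mulr1.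
exact: (is_deriveD dA dG).
Unshelve. all: by end_near.
Qed.

Lemma is_solution_is_derive (R : realType) (c kappa : R) (N : R -> R) (x : R) :
  is_solution c kappa N -> x \in `]0, 1[%R ->
  is_derive x 1 N (- 2 + expR (- (c / kappa * N x * (N x + x + kappa - 1)))).
Proof.
move=> [Nc Neq]; apply: integral_equation_is_derive Neq.
exact: within_continuous_expR_quadratic.
Qed.

Lemma within_continuous_dist (R : realType) (f : R -> R) (a b s e : R) :
  {within `[a, b], continuous f} -> a <= s <= b -> 0 < e ->
  exists2 d : R, 0 < d &
    forall y, a <= y <= b -> `|y - s| < d -> `|f y - f s| < e.
Proof.
move=> fc sab e0.
have sA : `[a, b]%classic s by rewrite /= in_itv.
have /cvgrPdist_lt/(_ _ e0) := fc s.
move/(nbhs_subspace_ex _ sA) => [V /nbhs_ballP[d /= d0 dV] VE].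
exists d => // y yab yd; rewrite distrC.
suff [] : ([set t | `|f s - f t| < e] `&` `[a, b]%classic) y by [].
rewrite VE; split; last by rewrite /= in_itv.
by apply: dV; rewrite /ball/= distrC.
Qed.

(** Let [s] be the last time with [0 <= f s]. Just after [s] the values lie in the strip between
    [- d] and 0, where the slope is nonnegative, and the mean value theorem contradicts [f < 0]
    there. Invariant regions of the differential equation are obtained from this sign condition in a
    thin strip. *)
Lemma barrier (R : realType) (f df : R -> R) (a b d : R) :
  a <= b -> 0 < d -> {within `[a, b], continuous f} ->
  (forall x, x \in `]a, b[%R -> is_derive x 1 f (df x)) ->
  0 <= f a ->
  (forall x, x \in `]a, b[%R -> - d < f x < 0 -> 0 <= df x) -> 0 <= f b.
Proof.
move=> ab d0 fc fd fa H; rewrite leNgt; apply/negP => fb.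
pose S := [set t : R | a <= t <= b /\ 0 <= f t].
have Sa : S a by split=> //; rewrite lexx.
have hS : has_sup S by split; [exists a | exists b => t [/andP[]]].
pose s := sup S.
have as_ : a <= s by apply: ub_le_sup => //; case: hS.
have sb : s <= b by apply: ge_sup; [exists a | move=> t [/andP[]]].
have asb : a <= s <= b by rewrite as_.
have after x : s < x -> x <= b -> f x < 0.
  move=> sx xb; rewrite ltNge; apply/negP => fx.
  suff : x <= s by rewrite leNgt sx.
  apply: ub_le_sup; first by case: hS.
  by split=> //; rewrite xb (le_trans as_ (ltW sx)).
have fs : 0 <= f s.
  rewrite leNgt; apply/negP => fs0.
  have [|e e0 He] := @within_continuous_dist R f a b s (- f s) fc asb.
    by rewrite oppr_gt0.
  have [t St st] := sup_adherent e0 hS.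
  have ts : t <= s by apply: ub_le_sup => //; case: hS.
  have [tab ft] := St.
  have td : `|t - s| < e by rewrite ler0_norm ?subr_le0//; rewrite -/s in st; lra.
  have := ltr_normlW (He t tab td); lra.
have sltb : s < b by rewrite lt_neqAle sb andbT; apply/eqP => E; move: fb; rewrite -E; lra.
have [e e0 He] := @within_continuous_dist R f a b s d fc asb d0.
have [y [sy yb ye]] : exists y, [/\ s < y, y <= b & y <= s + e / 2].
  exists (Num.min b (s + e / 2)); split; last by rewrite ge_min lexx orbT.
    by rewrite lt_min sltb; lra.
  by rewrite ge_min lexx.
have fd' x : x \in `]s, y[%R -> is_derive x 1 f (df x).
  by rewrite in_itv/= => /andP[sx xy]; apply: fd; rewrite in_itv/=; apply/andP; split; lra.
have fc' : {within `[s, y], continuous f}.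
  by apply: continuous_subspaceW fc => x /=; rewrite !in_itv/= => /andP[sx xy]; apply/andP; split; lra.
have [r] := MVT sy fd' fc'.
rewrite in_itv/= => /andP[sr ry] E.
have : 0 <= df r * (y - s).
  apply: mulr_ge0; last lra.
  apply: H; first by rewrite in_itv/=; apply/andP; split; lra.
  have -> : f r < 0 by apply: after => //; lra.
  have rab : a <= r <= b by apply/andP; split; lra.
  have rd : `|r - s| < e by rewrite gtr0_norm; lra.
  by have := He r rab rd; rewrite ltr_norml => /andP[]; lra.
have := after y sy yb; lra.
Qed.

Lemma expRN_lipschitz (R : realType) (u v : R) :
  0 <= u -> 0 <= v -> `|expR (- u) - expR (- v)| <= `|u - v|.
Proof.
wlog uv : u v / u <= v.
  move=> W u0 v0; have [uv|/ltW vu] := leP u v; first exact: W.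
  by rewrite distrC (distrC u); exact: W.
move=> u0 v0.
have e1 : expR (- u) <= 1 by rewrite expR_le1 oppr_le0.
have ep : 0 <= expR (- u) by exact: expR_ge0.
have eq : expR (- v) = expR (- u) * expR (- (v - u)) by rewrite -expRD; congr expR; ring.
have g : 1 - (v - u) <= expR (- (v - u)) by exact: expR_ge1Dx.
have l1 : expR (- (v - u)) <= 1 by rewrite expR_le1 oppr_le0 subr_ge0.
rewrite (ler0_norm (x := u - v)) ?subr_le0// ger0_norm ?eq; nra.
Qed.

Lemma expR_half_le2 (R : realType) (y : R) : y <= 1 / 2 -> expR y <= 2.
Proof.
move=> y1; apply: (@le_trans _ _ (expR (1 / 2))); first by rewrite ler_expR.
have h : 1 / 2 <= expR (- (1 / 2) : R) by apply: le_trans (expR_ge1Dx _); lra.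
have := expRxMexpNx_1 (1 / 2 : R); nra.
Qed.

(* The limiting density of matched edges at time [t], when [N t] is the density
   of unmatched vertices: a round removes one vertex more when it matches. *)
Definition matched (R : realType) (N : R -> R) (t : R) : R := 1 - t - N t.

(** * Sign and monotonicity of a solution up to its root *)

Section solution.
Context (R : realType) (c kappa : R) (N : R -> R).
Hypotheses (c_gt0 : 0 < c) (kappa_gt0 : 0 < kappa).
Hypothesis solN : is_solution c kappa N.

Local Notation J := (matched N).

Lemma solution0 : N 0 = 1.
Proof.
have [_ ->] := solN; last by rewrite lexx ler01.
by rewrite set_itv1 Rintegral_set1; ring.
Qed.

Lemma solution_within_continuous a b : 0 <= a -> b <= 1 ->
  {within `[a, b], continuous N}.
Proof.
move=> a0 b1; case: solN => + _; apply: continuous_subspaceW => x /=.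
by rewrite !in_itv/= => /andP[ax xb]; apply/andP; split; lra.
Qed.

Lemma is_derive_matched (x : R) : x \in `]0, 1[%R ->
  is_derive x 1 J (1 - expR (- (c / kappa * N x * (kappa - J x)))).
Proof.
move=> x01; have dN := is_solution_is_derive solN x01.
have dJ : is_derive x 1 J _ :=
  is_deriveB (is_deriveB (is_derive_cst (1 : R) x 1) (is_derive_id x 1)) dN.
apply: (is_derive_eq dJ).
rewrite (_ : N x + x + kappa - 1 = kappa - J x); last by rewrite /matched; ring.
by ring.
Qed.

Lemma matched_within_continuous a b : 0 <= a -> b <= 1 ->
  {within `[a, b], continuous J}.
Proof.
move=> a0 b1; apply: within_continuousB; last exact: solution_within_continuous.
by apply: continuous_subspaceT => x; apply: cvgB; [exact: cvg_cst|exact: cvg_id].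
Qed.

Lemma matched_MVT s t : 0 <= s -> s < t -> t <= 1 ->
  exists2 x, s < x < t &
    J t - J s = (1 - expR (- (c / kappa * N x * (kappa - J x)))) * (t - s).
Proof.
move=> s0 st t1; have dJ x : x \in `]s, t[%R ->
    is_derive x 1 J (1 - expR (- (c / kappa * N x * (kappa - J x)))).
  rewrite in_itv/= => /andP[sx xt]; apply: is_derive_matched.
  by rewrite in_itv/=; apply/andP; split; lra.
have [x xst E] := MVT st dJ (matched_within_continuous s0 t1).
by exists x => //; move: xst; rewrite in_itv.
Qed.

(* [N] has slope -1 wherever it vanishes, so it crosses 0 only once. *)
Lemma solution_ge0 tau0 t : tau0 <= 1 -> N tau0 = 0 -> 0 <= t <= tau0 -> 0 <= N t.
Proof.
move=> tau0_le1 Ntau0 /andP[t0 tt]; rewrite leNgt; apply/negP => Nt.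
(* While [- e < N < 0], the exponent is at most [c / kappa * e * (kappa + 2) <= 1 / 2], so the
   exponential is at most 2 and [N] does not increase. Hence [N] stays below [- e] from [t] on and
   cannot vanish at [tau0]. *)
pose e := Num.min (- N t) (Num.min 1 (kappa / (2 * c * (kappa + 2)))).
have e0 : 0 < e.
  by rewrite !lt_min oppr_gt0 Nt ltr01/= divr_gt0// !mulr_gt0// addr_gt0.
have eN : e <= - N t by rewrite ge_min lexx.
have e1 : e <= 1 by rewrite !ge_min lexx ?orbT.
have e2 : e <= kappa / (2 * c * (kappa + 2)) by rewrite !ge_min lexx ?orbT.
suff : 0 <= - N tau0 - e by rewrite Ntau0; lra.
apply: (@barrier R (fun x => - N x - e)
  (fun x => - (- 2 + expR (- (c / kappa * N x * (N x + x + kappa - 1)))) - 0)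
  t tau0 e tt e0).
- apply: (@within_continuousB _ _ _ `[t, tau0]%classic (fun x => - N x) (fun=> e)).
    by move=> x; apply: cvgN; exact: (solution_within_continuous t0 tau0_le1).
  by move=> x; exact: cvg_cst.
- move=> x; rewrite in_itv/= => /andP[tx xt].
  have x01 : x \in `]0, 1[%R by rewrite in_itv/=; have tl := tau0_le1; apply/andP; split; lra.
  have dN := is_solution_is_derive solN x01.
  exact: (is_deriveB (is_deriveN dN) (is_derive_cst e x 1)).
- by lra.
- move=> x; rewrite in_itv/= => /andP[tx xt] /andP[h1 h2].
  suff : expR (- (c / kappa * N x * (N x + x + kappa - 1))) <= 2 by lra.
  apply: expR_half_le2.
  have ck : 0 < c / kappa by rewrite divr_gt0.
  have eB : c / kappa * (e * (kappa + 2)) <= 1 / 2.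
    rewrite mulrAC ler_pdivrMr//.
    move: e2; rewrite ler_pdivlMr ?mulr_gt0 ?addr_gt0//.
    by lra.
  rewrite (_ : - _ = c / kappa * ((- N x) * (N x + x + kappa - 1))); last by ring.
  apply: le_trans eB; rewrite ler_pM2l//.
  have [k0 tl] := (kappa_gt0, tau0_le1).
  have p1 : 0 <= (- N x) * (kappa + 2 - (N x + x + kappa - 1)) by apply: mulr_ge0; lra.
  have p2 : 0 <= (e + N x) * (kappa + 2) by apply: mulr_ge0; lra.
  by nra.
Qed.

Context (tau0 : R).
Hypotheses (tau0_le1 : tau0 <= 1) (N_ge0 : forall t, 0 <= t <= tau0 -> 0 <= N t).

(** Colours cannot be overspent: if [J] exceeded [kappa] while [N] is nonnegative, the exponent
    would be nonnegative and [J] would not increase. *)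
Lemma matched_le_kappa t : 0 <= t <= tau0 -> J t <= kappa.
Proof.
move=> /andP[t0 tt]; rewrite -subr_ge0.
have t1 : t <= 1 by apply: le_trans tt tau0_le1.
apply: (@barrier R (fun x => kappa - J x)
  (fun x => 0 - (1 - expR (- (c / kappa * N x * (kappa - J x))))) 0 t 1 t0 ltr01).
- apply: (@within_continuousB _ _ _ `[0, t]%classic (fun=> kappa) J).
    by move=> x; exact: cvg_cst.
  exact: matched_within_continuous.
- move=> x; rewrite in_itv/= => /andP[tx xt].
  apply: (is_deriveB (is_derive_cst kappa x 1)); apply: is_derive_matched.
  by rewrite in_itv/=; have tl := tau0_le1; apply/andP; split; lra.
- by rewrite /matched solution0; have := kappa_gt0; lra.
- move=> x; rewrite in_itv/= => /andP[tx xt] /andP[_ h].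
  rewrite sub0r oppr_ge0 subr_le0 -expR0 ler_expR oppr_ge0.
  have ck : 0 < c / kappa by rewrite divr_gt0.
  have Nx : 0 <= N x by apply: N_ge0; apply/andP; split; lra.
  by apply: mulr_ge0_le0 (ltW h); exact: mulr_ge0 (ltW ck) Nx.
Qed.

Lemma matched_increment s t : 0 <= s -> s <= t -> t <= tau0 ->
  0 <= J t - J s <= t - s.
Proof.
move=> s0; rewrite le_eqVlt => /predU1P[-> _|st tt]; first by rewrite !subrr lexx.
have [x /andP[sx xt] ->] := matched_MVT s0 st (le_trans tt tau0_le1).
have ck : 0 < c / kappa by rewrite divr_gt0.
have xt0 : 0 <= x <= tau0 by apply/andP; split; lra.
have Nx := N_ge0 xt0; have Jx := matched_le_kappa xt0.
have e1 : expR (- (c / kappa * N x * (kappa - J x))) <= 1.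
  rewrite expR_le1 oppr_le0; apply: mulr_ge0; last by rewrite subr_ge0.
  exact: mulr_ge0 (ltW ck) Nx.
have e0 := expR_ge0 (- (c / kappa * N x * (kappa - J x))).
by apply/andP; split; nra.
Qed.

Lemma matched_ge0 t : 0 <= t <= tau0 -> 0 <= J t.
Proof.
move=> /andP[t0 tt]; have /andP[+ _] := matched_increment (lexx 0) t0 tt.
by rewrite {2}/matched solution0; lra.
Qed.

End solution.

(** * The truncated drift, the stopped curve and the location of the root *)

Section rate.
Context (R : realType) (c kappa : R).
Hypotheses (c_gt0 : 0 < c) (kappa_gt0 : 0 < kappa).

(* The limiting probability that a round at time [t] matches, when the density
   of matched edges is [j].  The truncations freeze it once no vertex is left. *)
Definition rate (t j : R) : R :=
  1 - expR (- (c / kappa * Num.max 0 (1 - t - j) * Num.max 0 (kappa - j))).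

Let L : R := c / kappa * (kappa + 1).

Lemma max0_lipschitz (x y : R) : `|Num.max 0 x - Num.max 0 y| <= `|x - y|.
Proof.
rewrite ler_norml; have := ler_norm (x - y); have := lerNnormlW (lexx `|x - y|).
by case: (leP 0 x) => hx; case: (leP 0 y) => hy h1 h2; apply/andP; split; lra.
Qed.

(** The two truncated factors lie in [0, 1] and [0, [kappa]] and are 1-Lipschitz in [t + j] and in
    [j]; their product has constant [kappa + 1], and [expR (- x)] is 1-Lipschitz for [0 <= x]. *)
Lemma rate_lipschitz s t a b : 0 <= s -> 0 <= t -> 0 <= a -> 0 <= b ->
  `|rate s a - rate t b| <= L * (`|s - t| + `|a - b|).
Proof.
move=> s0 t0 a0 b0; rewrite /rate.
set u := Num.max 0 (1 - s - a); set u' := Num.max 0 (1 - t - b).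
set v := Num.max 0 (kappa - a); set v' := Num.max 0 (kappa - b).
have ck : 0 < c / kappa by rewrite divr_gt0.
have u0 : 0 <= u by rewrite le_max lexx.
have u'0 : 0 <= u' by rewrite le_max lexx.
have u'1 : u' <= 1 by rewrite ge_max ler01/=; lra.
have v0 : 0 <= v by rewrite le_max lexx.
have v'0 : 0 <= v' by rewrite le_max lexx.
have vk : v <= kappa by have k0 := kappa_gt0; rewrite ge_max (ltW k0)/=; lra.
have -> : 1 - expR (- (c / kappa * u * v)) - (1 - expR (- (c / kappa * u' * v')))
    = expR (- (c / kappa * u' * v')) - expR (- (c / kappa * u * v)) by ring.
have cku w z : 0 <= w -> 0 <= z -> 0 <= c / kappa * w * z.
  by move=> w0 z0; apply: mulr_ge0 z0; exact: mulr_ge0 (ltW ck) w0.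
apply: le_trans (expRN_lipschitz (cku _ _ u'0 v'0) (cku _ _ u0 v0)) _.
rewrite (_ : _ - _ = c / kappa * (u' * v' - u * v)); last by ring.
rewrite normrM (gtr0_norm ck) /L -[leRHS]mulrA ler_pM2l//.
have du : `|u' - u| <= `|s - t| + `|a - b|.
  apply: le_trans (max0_lipschitz _ _) _.
  rewrite (_ : _ - _ = (s - t) + (a - b)); last by ring.
  exact: ler_normD.
have dv : `|v' - v| <= `|a - b|.
  apply: le_trans (max0_lipschitz _ _) _.
  by rewrite (_ : _ - _ = (a - b)); last by ring.
have -> : u' * v' - u * v = u' * (v' - v) + (u' - u) * v by ring.
apply: le_trans (ler_normD _ _) _; rewrite !normrM (ger0_norm u'0) (ger0_norm v0).
have := normr_ge0 (s - t); have := normr_ge0 (a - b).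
have := normr_ge0 (v' - v); have := normr_ge0 (u' - u).
have k0 := kappa_gt0.
move=> h1 h2 h3 h4.
have p1 : u' * `|v' - v| <= 1 * `|a - b| by apply: ler_pM.
have p2 : `|u' - u| * v <= (`|s - t| + `|a - b|) * kappa by apply: ler_pM.
lra.
Qed.

Context (N : R -> R) (tau0 : R).
Hypothesis solN : is_solution c kappa N.
Hypotheses (tau0_ge0 : 0 <= tau0) (tau0_le1 : tau0 <= 1) (Ntau0 : N tau0 = 0).

Local Notation J := (matched N).

Let Nge0 t : 0 <= t <= tau0 -> 0 <= N t.
Proof. exact: (solution_ge0 c_gt0 kappa_gt0 solN tau0_le1 Ntau0). Qed.

Let Jinc := matched_increment c_gt0 kappa_gt0 solN tau0_le1 Nge0.
Let Jge0 := matched_ge0 c_gt0 kappa_gt0 solN tau0_le1 Nge0.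
Let Jlek := matched_le_kappa c_gt0 kappa_gt0 solN tau0_le1 Nge0.

Let L_gt0 : 0 < L.
Proof. by rewrite mulr_gt0 ?divr_gt0 ?addr_gt0. Qed.

(** By the mean value theorem the increment is the drift at an intermediate point times [t - s].
    Time and [J] both move by at most [t - s] up to that point, which gives the factor 2. *)
Lemma matched_rate_increment s t : 0 <= s -> s <= t -> t <= tau0 ->
  `|J t - J s - rate s (J s) * (t - s)| <= 2 * L * (t - s) ^+ 2.
Proof.
move=> s0; rewrite le_eqVlt => /predU1P[-> _|st tt].
  by rewrite !subrr mulr0 subrr normr0 expr0n mulr0.
have [x /andP[sx xt] ->] := matched_MVT solN s0 st (le_trans tt tau0_le1).
have xt0 : 0 <= x <= tau0 by apply/andP; split; lra.
have st0 : 0 <= s <= tau0 by apply/andP; split; lra.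
have -> : 1 - expR (- (c / kappa * N x * (kappa - J x))) = rate x (J x).
  rewrite /rate (max_r (x := 0) (y := kappa - _)) ?subr_ge0 ?Jlek//.
  by rewrite (_ : 1 - x - J x = N x) ?(max_r (Nge0 xt0))// /matched; ring.
rewrite -mulrBl normrM (gtr0_norm (x := t - s)) ?subr_gt0// expr2 mulrA.
rewrite ler_pM2r ?subr_gt0//.
apply: le_trans (rate_lipschitz _ _ _ _) _; rewrite ?Jge0//; [lra|].
have xt' : x <= tau0 by lra.
have /andP[j0 j1] := Jinc s0 (ltW sx) xt'.
rewrite !ger0_norm//; last by lra.
rewrite (_ : 2 * L * (t - s) = L * (2 * (t - s))); last by ring.
by rewrite ler_pM2l//; lra.
Qed.

(** Since [J tau0 = 1 - tau0], the truncated drift at this frozen value is 0 at every later time, so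
    the stopped curve follows [rate] beyond [tau0] too. *)
Definition stopped (t : R) : R := J (Num.min t tau0).

Lemma stopped0 : stopped 0 = 0.
Proof. by rewrite /stopped min_l// /matched (solution0 solN); ring. Qed.

Lemma stopped1 : stopped 1 = 1 - tau0.
Proof. by rewrite /stopped min_r// /matched Ntau0 subr0. Qed.

Lemma stopped_ge0 t : 0 <= t -> 0 <= stopped t.
Proof. by move=> t0; apply: Jge0; rewrite le_min t0 tau0_ge0 ge_min lexx orbT. Qed.

Lemma rate_frozen t : tau0 <= t -> rate t (J tau0) = 0.
Proof.
move=> tt; rewrite /rate /matched Ntau0 (max_l (x := 0) (y := 1 - t - _)); last by lra.
by rewrite mulr0 mul0r oppr0 expR0 subrr.
Qed.

Lemma stopped_increment s t : 0 <= s -> s <= t ->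
  `|stopped t - stopped s - rate s (stopped s) * (t - s)| <= 2 * L * (t - s) ^+ 2.
Proof.
move=> s0 st; rewrite /stopped.
have L0 := L_gt0.
have [tt|tt] := leP t tau0.
  by rewrite [Num.min s _]min_l ?(le_trans st)//; exact: matched_rate_increment.
have [ss|ss] := leP tau0 s.
  rewrite rate_frozen// mul0r !subrr normr0.
  by apply: mulr_ge0 (sqr_ge0 _); rewrite mulr_ge0// ltW.
have h1 := matched_rate_increment s0 (ltW ss) (lexx _).
have /andP[j0 j1] := Jinc s0 (ltW ss) (lexx _).
have s1 : 0 <= s <= tau0 by rewrite s0 ltW.
have t1 : 0 <= tau0 <= tau0 by rewrite lexx andbT; exact: tau0_ge0.
have h2 := rate_lipschitz s0 tau0_ge0 (Jge0 s1) (Jge0 t1).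
rewrite (rate_frozen (lexx tau0)) subr0 in h2.
rewrite (ler0_norm (x := s - _)) ?subr_le0 ?(ltW ss)// in h2.
rewrite (ler0_norm (x := J s - _)) in h2; last by lra.
(* The interval straddles [tau0]. The drift at [s], charged over [[tau0, t]], is small because it is
   within [2 * L * (tau0 - s)] of the zero drift at [tau0]; the resulting product is a cross term of
   the square of [t - s]. *)
have -> : J tau0 - J s - rate s (J s) * (t - s) =
  (J tau0 - J s - rate s (J s) * (tau0 - s)) - rate s (J s) * (t - tau0) by ring.
apply: le_trans (ler_normB _ _) _; rewrite normrM (gtr0_norm (x := t - _)) ?subr_gt0//.
have h3 : `|rate s (J s)| * (t - tau0) <= 2 * L * (tau0 - s) * (t - tau0).
  rewrite ler_pM2r ?subr_gt0//; apply: le_trans h2 _.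
  rewrite (_ : 2 * L * (tau0 - s) = L * (2 * (tau0 - s))); last by ring.
  by rewrite ler_pM2l//; lra.
have p : 0 <= (2 * L) * ((tau0 - s) * (t - tau0) + (t - tau0) ^+ 2).
  apply: mulr_ge0; first by rewrite mulr_ge0// ltW.
  by rewrite addr_ge0 ?sqr_ge0// mulr_ge0// subr_ge0 ltW.
by nra.
Qed.

(** If [tau0 = 1], the nondecreasing [J] runs from 0 to 0, so it vanishes and [N x = 1 - x]. A zero
    slope of [J] inside the interval then forces [N x = 0], a contradiction. This keeps the relative
    error in (a) meaningful. *)
Lemma tau0_lt1 : tau0 < 1.
Proof.
rewrite lt_neqAle tau0_le1 andbT; apply/eqP => tE.
have Jz t : 0 <= t <= 1 -> J t = 0.
  move=> /andP[t0 t1]; have tt : t <= tau0 by rewrite tE.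
  have := Jinc t0 tt (lexx _); rewrite {1}/matched Ntau0 tE => /andP[h _].
  have : 0 <= J t by apply: Jge0; rewrite t0.
  lra.
have [x /andP[x0 x1]] := matched_MVT solN (lexx 0) ltr01 (lexx 1).
have J0 : J 0 = 0 by apply: Jz; rewrite lexx ler01.
have J1 : J 1 = 0 by apply: Jz; rewrite lexx ler01.
have Jx : J x = 0 by apply: Jz; rewrite !ltW.
rewrite J0 J1 Jx !subr0 mulr1 => /esym/eqP.
rewrite subr_eq0 => /eqP/esym/(congr1 (@ln R)); rewrite expRK ln1 => /eqP.
have Nx : N x = 1 - x by move: Jx; rewrite /matched; lra.
rewrite oppr_eq0 Nx !mulf_eq0 invr_eq0 (gt_eqF c_gt0) (gt_eqF kappa_gt0)/= orbF.
by rewrite gt_eqF// subr_gt0.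
Qed.

(* Along the solution [N' >= - (2 - expR (- (c * N)))] because some colours are
   already used; this is compared with the mean [A] of the right-hand side over
   [N] in [0, 1] through the tangent inequality [1 / y >= 2 / A - y / A ^+ 2]. *)
Lemma tau0_gt : c / (2 * c - 1 + expR (- c)) < tau0.
Proof.
have c0 := c_gt0; have tl := tau0_le1.
pose A := (2 * c - 1 + expR (- c)) / c.
have A1 : 1 <= A.
  rewrite ler_pdivlMr// mul1r; have := expR_ge1Dx (- c); lra.
have A0 : 0 < A by exact: lt_le_trans ltr01 A1.
have -> : c / (2 * c - 1 + expR (- c)) = A^-1 by rewrite /A invf_div.
have t0 : 0 < tau0.
  rewrite lt_neqAle tau0_ge0 andbT; apply/eqP => E.
  by move: Ntau0; rewrite -E (solution0 solN) => /eqP; rewrite oner_eq0.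
pose y (t : R) := 2 - expR (- (c * N t)).
pose dN (t : R) := - 2 + expR (- (c / kappa * N t * (N t + t + kappa - 1))).
pose B := c^-1 / A ^+ 2.
(* [f] is built to have slope [(2 / A - y / A ^+ 2) * N' + 1], which is at least [(1 - y / A) ^+ 2].
   As [A] is the mean of [2 - expR (- (c * N))] over [N] in [0, 1], its total increment is exactly
   [tau0 - A^-1]; monotonicity thus gives the weak inequality. *)
pose f := (fun t => (2 / A - 2 / A ^+ 2) * N t + - (B * expR (- (c * N t))) + t).
pose df (t : R) := (2 / A - y t / A ^+ 2) * dN t + 1.
have fd x : 0 < x -> x < tau0 -> is_derive x 1 f (df x).
  move=> x0 xt.
  have x01 : x \in `]0, 1[%R by rewrite in_itv/=; apply/andP; split; lra.
  have dNx : is_derive x 1 N (dN x) := is_solution_is_derive solN x01.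
  have d1 : is_derive x 1 (fun t : R => - (c * N t)) (- (c * dN x)).
    exact: (is_deriveN (is_deriveZ c dNx)).
  have d2 : is_derive x 1 (fun t : R => expR (- (c * N t)))
      (expR (- (c * N x)) * - (c * dN x)).
    exact: (@is_derive1_comp _ expR (fun t => - (c * N t)) x _ _ (is_derive_expR _) d1).
  have d3 := is_deriveD (is_deriveD (is_deriveZ (2 / A - 2 / A ^+ 2) dNx)
    (is_deriveN (is_deriveZ B d2))) (is_derive_id x 1).
  apply: (is_derive_eq d3); rewrite /df /y /B /=.
  rewrite /GRing.scale/=; field.
  by rewrite !gt_eqF.
have fc a b : 0 <= a -> b <= tau0 -> {within `[a, b], continuous f}.
  move=> a0 bt; have Nc := solution_within_continuous solN a0 (le_trans bt tau0_le1).
  have idc : {within `[a, b], continuous (fun s : R => s)}.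
    by apply: continuous_subspaceT => x; exact: cvg_id.
  have Ec : {within `[a, b], continuous (fun s => expR (- (c * N s)))}.
    apply: (@within_continuous_comp _ _ _ `[a, b]%classic _ expR).
      by move=> x _; exact: continuous_expR.
    by move=> x; apply: cvgN; apply: cvgMr; exact: Nc.
  move=> x; apply: cvgD; last exact: idc.
  apply: cvgD; first by apply: cvgMr; exact: Nc.
  by apply: cvgN; apply: cvgMr; exact: Ec.
have fmvt a b : 0 <= a -> a < b -> b <= tau0 ->
    exists2 x, a < x < b & f b - f a = df x * (b - a).
  move=> a0 ab bt.
  have fd' x : x \in `]a, b[%R -> is_derive x 1 f (df x).
    by rewrite in_itv/= => /andP[ax xb]; apply: fd; lra.
  have [x] := MVT ab fd' (fc a b a0 bt).
  by rewrite in_itv/= => axb E; exists x.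
have dfge x : 0 < x < tau0 -> (1 - y x / A) ^+ 2 <= df x.
  move=> /andP[x0 xt]; have xt0 : 0 <= x <= tau0 by rewrite !ltW.
  have y2 : y x <= 2 by rewrite lerBlDr lerDl expR_ge0.
  have K0 : 0 <= 2 / A - y x / A ^+ 2.
    rewrite (_ : _ - _ = (2 * A - y x) / A ^+ 2); last by field; rewrite gt_eqF.
    by rewrite divr_ge0 ?sqr_ge0//; lra.
  have dNy : - y x <= dN x.
    rewrite /y /dN opprB addrC lerD2l ler_expR lerN2.
    have -> : N x + x + kappa - 1 = kappa - J x by rewrite /matched; ring.
    have -> : c / kappa * N x * (kappa - J x) = c * N x - c / kappa * (N x * J x).
      by field; rewrite gt_eqF.
    rewrite lerBlDr lerDl; apply: mulr_ge0; first by rewrite divr_ge0// ltW.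
    by apply: mulr_ge0; [exact: Nge0 | exact: Jge0].
  have -> : (1 - y x / A) ^+ 2 = (2 / A - y x / A ^+ 2) * (- y x) + 1.
    by field; rewrite gt_eqF.
  by rewrite lerD2r; exact: ler_wpM2l.
have fmono a b : 0 <= a -> a <= b -> b <= tau0 -> f a <= f b.
  move=> a0; rewrite le_eqVlt => /predU1P[->//|ab bt].
  have [x /andP[ax xb] E] := fmvt a b a0 ab bt.
  have x01 : 0 < x < tau0 by apply/andP; split; lra.
  rewrite -subr_ge0 E mulr_ge0 ?subr_ge0 ?(ltW ab)//.
  exact: le_trans (sqr_ge0 _) (dfge x x01).
have f0t : f tau0 - f 0 = tau0 - A^-1.
  rewrite /f Ntau0 (solution0 solN) /B /A !mulr0 oppr0 expR0 !mulr1.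
  have c' : 2 * c - 1 + expR (- c) != 0.
    by move: A0; rewrite /A pmulr_lgt0 ?invr_gt0// => /lt0r_neq0.
  by field; rewrite c' gt_eqF.
(* Strictness: if [f] has no increment, it is constant, so [y = A] somewhere in each half of
   [[0, tau0]]. Then [N] takes the same value twice, although [1 - t - N t] is nondecreasing. *)
rewrite -subr_gt0 -f0t subr_gt0 lt_neqAle fmono// andbT; apply/eqP => fE.
have fcst a : 0 <= a <= tau0 -> f a = f 0.
  move=> /andP[a0 at0]; apply/le_anti/andP; split; last exact: fmono.
  by rewrite fE; exact: fmono.
have yA a b : 0 <= a -> a < b -> b <= tau0 -> exists2 x, a < x < b & y x = A.
  move=> a0 ab bt; have [x axb] := fmvt a b a0 ab bt.
  rewrite !fcst ?subrr; [|apply/andP; split; lra..].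
  move/esym/eqP; rewrite mulf_eq0 (gt_eqF (x := b - a)) ?subr_gt0// orbF => /eqP d0.
  exists x => //; have x01 : 0 < x < tau0.
    by move: axb => /andP[ax xb]; apply/andP; split; lra.
  have := dfge x x01; rewrite d0 real_exprn_even_le0//= ?num_real//.
  by rewrite subr_eq0 => /eqP E; rewrite -[RHS]mul1r E divfK// gt_eqF.
have th0 : 0 < tau0 / 2 by lra.
have tht : tau0 / 2 < tau0 by lra.
have [x1 /andP[x10 x1h] y1] := yA 0 (tau0 / 2) (lexx _) th0 (ltW tht).
have [x2 /andP[x2h x2t] y2] := yA (tau0 / 2) tau0 (ltW th0) tht (lexx _).
have : N x1 = N x2.
  have := congr1 (fun z => 2 - z) (etrans y1 (esym y2)); rewrite /y !subKr.
  by move=> /expR_inj/oppr_inj/(mulfI (lt0r_neq0 c0)).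
have := Jinc (ltW x10) (ltW (lt_trans x1h x2h)) (ltW x2t); rewrite /matched.
by move=> /andP[]; lra.
Qed.

End rate.

(** * Picard iteration for a Lipschitz integral equation *)

Section picard.
Context (R : realType).
Implicit Types (f g h : R -> R) (t : R).

Let mu := @lebesgue_measure R.

Lemma within_continuous_integrable f t : t <= 1 ->
  {within `[0, 1], continuous f} -> mu.-integrable `[0, t] (EFin \o f).
Proof.
move=> t1 fc; apply: continuous_compact_integrable; first exact: segment_compact.
by apply: continuous_subspaceW fc => x /=; rewrite !in_itv/= => /andP[-> /le_trans]; apply.
Qed.

Lemma le_dist_Rintegral f g h t : t <= 1 ->
  {within `[0, 1], continuous f} -> {within `[0, 1], continuous g} ->
  {within `[0, 1], continuous h} ->
  (forall s, 0 <= s <= t -> `|f s - g s| <= h s) ->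
  `|\int[mu]_(s in `[0, t]) f s - \int[mu]_(s in `[0, t]) g s|
    <= \int[mu]_(s in `[0, t]) h s.
Proof.
move=> t1 fc gc hc H.
have fi := within_continuous_integrable t1 fc.
have gi := within_continuous_integrable t1 gc.
rewrite -RintegralB//.
have dc : {within `[0, 1], continuous (fun s => f s - g s)} by exact: within_continuousB.
have di := within_continuous_integrable t1 dc.
apply: le_trans (le_normr_Rintegral _ di) _ => //.
apply: le_Rintegral => //.
- apply: within_continuous_integrable => //.
  by move=> x; apply: cvg_norm; exact: dc.
- exact: within_continuous_integrable.
Qed.

Lemma Rintegral_itv_cst (b t : R) : 0 <= t ->
  \int[mu]_(s in `[0, t]) b = b * t.
Proof.
move=> t0; have E : lebesgue_measure (`[0, t]%classic : set R) = t%:E.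
  rewrite lebesgue_measure_itv/= lte_fin; case: ltP => [_|t0']; first by rewrite oppr0 adde0.
  by congr EFin; apply/le_anti; rewrite t0.
by rewrite Rintegral_cst//; congr (b * _); exact: (congr1 fine E).
Qed.

Lemma Rintegral_expR (K t : R) : 0 < K -> 0 <= t ->
  \int[mu]_(s in `[0, t]) (K * expR (K * s)) = expR (K * t) - 1.
Proof.
move=> K0; rewrite le_eqVlt => /predU1P[<-|t0].
  by rewrite set_itv1 Rintegral_set1 mulr0 expR0 subrr.
have dF (x : R) : is_derive x 1 (fun s : R => expR (K * s)) (K * expR (K * x)).
  have d1 : is_derive x 1 (fun s : R => K * s) K.
    by apply: (is_derive_eq (is_deriveZ K (is_derive_id x 1))); rewrite [_ *: _]mulr1.
  apply: (is_derive_eq (@is_derive1_comp _ expR _ x _ _ (is_derive_expR _) d1)).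
  by rewrite mulrC.
have Fc : continuous (fun s : R => expR (K * s)).
  move=> x; apply: differentiable_continuous; apply/derivable1_diffP.
  by case: (dF x).
rewrite /Rintegral (@continuous_FTC2 _ _ (fun s => expR (K * s)))//.
- by rewrite -EFinB/= mulr0 expR0.
- by apply: continuous_subspaceT => x; apply: cvgMr; exact: Fc.
- split.
  + by move=> x _; case: (dF x).
  + exact/cvg_at_right_filter/Fc.
  + exact/cvg_at_left_filter/Fc.
- by move=> x _; rewrite derive1E; case: (dF x).
Qed.

Lemma geometric_half_lt (D e : R) : 0 <= D -> 0 < e -> exists n, D * 2^-1 ^+ n < e.
Proof.
move=> D0 e0; have : (fun n => D * 2^-1 ^+ n) @ \oo --> D * 0.
  by apply: cvgMr; apply: cvg_expr; rewrite ger0_norm; lra.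
rewrite mulr0 => /cvgrPdist_lt/(_ _ e0)[n _ /(_ n (leqnn n))].
by rewrite sub0r normrN ger0_norm ?mulr_ge0 ?exprn_ge0//; exists n.
Qed.

Lemma within_continuous_uniform_approx f (D : R) : 0 <= D ->
  (forall n : nat, exists2 g : R -> R, {within `[0, 1], continuous g} &
     forall t, 0 <= t <= 1 -> `|f t - g t| <= D * 2^-1 ^+ n) ->
  {within `[0, 1], continuous f}.
Proof.
move=> D0 H s; have [sA|sA] := pselect (`[0, 1]%classic s); last first.
  (* Outside [0, 1] the subspace topology is discrete, so there is nothing to estimate. *)
  move=> U /= /nbhs_singleton Us; rewrite /nbhs/= -nbhs_subspace_out// => x ->.
  exact: Us.
have s01 : 0 <= s <= 1 by move: sA; rewrite /= in_itv.
apply/cvgrPdist_lt => e e0; have e3 : 0 < e / 3 by rewrite divr_gt0.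
have [n ne] := geometric_half_lt D0 e3.
have [g gc gf] := H n; have [d d0 gd] := within_continuous_dist gc s01 e3.
rewrite /nbhs/= -nbhs_subspace_in//; exists d => // y yd.
rewrite /= in_itv/= => y01.
have h1 := le_lt_trans (gf s s01) ne; have h2 := le_lt_trans (gf y y01) ne.
have h3 : `|g y - g s| < e / 3 by apply: gd => //; rewrite distrC.
rewrite (_ : f s - f y = (f s - g s) - (f y - g y) - (g y - g s)); last by ring.
have := ler_normB ((f s - g s) - (f y - g y)) (g y - g s).
have := ler_normB (f s - g s) (f y - g y); lra.
Qed.

Context (phi : R -> R -> R) (L B : R) (g : R -> R).
Hypotheses (L_gt0 : 0 < L) (g_cont : {within `[0, 1], continuous g}).
Hypothesis phi_cont : forall f, {within `[0, 1], continuous f} ->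
  {within `[0, 1], continuous (fun s => phi s (f s))}.
Hypothesis phi_lip : forall s a b, 0 <= s <= 1 ->
  `|phi s a - phi s b| <= L * `|a - b|.
Hypothesis phi_bnd : forall s a, 0 <= s <= 1 -> `|phi s a| <= B.

Let X (n : nat) : R -> R :=
  iter n (fun f t => g t + \int[mu]_(s in `[0, t]) phi s (f s)) g.

Let Xc n : {within `[0, 1], continuous (X n)}.
Proof.
elim: n => [//|n IH]; apply: within_continuousD => //.
apply: parameterized_integral_continuous; first exact: ler01.
exact: within_continuous_integrable (phi_cont IH).
Qed.

Let XS n t : X n.+1 t = g t + \int[mu]_(s in `[0, t]) phi s (X n s).
Proof. by []. Qed.

Let B_ge0 : 0 <= B.
Proof. by apply: le_trans (phi_bnd 0 (s := 0) _); rewrite ?lexx ?ler01. Qed.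

(** The weight [expR (2 * L * t)] (a Bielecki norm) makes each iteration contract by 1/2, whatever
    the size of [L]: the integral of [L * expR (2 * L * s)] up to [t] is less than half of the
    weight at [t]. *)
Let X_step n t : 0 <= t <= 1 ->
  `|X n.+1 t - X n t| <= B * expR (2 * L * t) * 2^-1 ^+ n.
Proof.
have cst_c (z : R) : {within `[0, 1], continuous (fun _ : R => z)}.
  by apply: continuous_subspaceT => x; exact: cvg_cst.
have L0 := L_gt0; have B0 := B_ge0.
elim: n t => [|n IH] t /andP[t0 t1].
  rewrite /= addrC addKr expr0 mulr1.
  have h : `|\int[mu]_(s in `[0, t]) phi s (g s) - \int[mu]_(s in `[0, t]) 0|
      <= \int[mu]_(s in `[0, t]) B.
    apply: (le_dist_Rintegral t1 (phi_cont g_cont) (cst_c 0) (cst_c B)).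
    move=> s /andP[s0 st]; rewrite subr0; apply: phi_bnd.
    by rewrite s0 (le_trans st).
  move: h; rewrite !Rintegral_itv_cst// mul0r subr0 => /le_trans; apply.
  by apply: ler_wpM2l => //; apply: le_trans (expR_ge1Dx _); nra.
rewrite (XS n.+1 t) (XS n t) opprD addrACA subrr add0r.
pose C := B * 2^-1 ^+ n.+1.
have C0 : 0 <= C by rewrite mulr_ge0// exprn_ge0.
have hc : {within `[0, 1], continuous (fun s : R => C * (2 * L * expR (2 * L * s)))}.
  apply: continuous_subspaceT => x; do 2 apply: cvgMr.
  apply: (@continuous_comp _ _ _ (fun s : R => 2 * L * s) expR).
    by apply: cvgMr; exact: cvg_id.
  exact: continuous_expR.
have h := le_dist_Rintegral t1 (phi_cont (@Xc n.+1)) (phi_cont (@Xc n)) hc.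
apply: le_trans (h _) _.
  move=> s /andP[s0 st]; have s01 : 0 <= s <= 1 by rewrite s0 (le_trans st).
  apply: le_trans (phi_lip _ _ s01) _.
  apply: le_trans (ler_wpM2l (ltW L0) (IH s s01)) _.
  by rewrite /C exprS le_eqVlt; apply/orP; left; apply/eqP; field.
rewrite RintegralZl//; last first.
  apply: within_continuous_integrable => //; apply: continuous_subspaceT => x.
  apply: cvgMr; apply: (@continuous_comp _ _ _ (fun s : R => 2 * L * s) expR).
    by apply: cvgMr; exact: cvg_id.
  exact: continuous_expR.
rewrite Rintegral_expR ?mulr_gt0//.
rewrite [leRHS](_ : _ = C * expR (2 * L * t)); last by rewrite /C mulrAC.
by apply: ler_wpM2l => //; lra.
Qed.

Lemma picard : exists2 f : R -> R, {within `[0, 1], continuous f} &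
  forall t, 0 <= t <= 1 -> f t = g t + \int[mu]_(s in `[0, t]) phi s (f s).
Proof.
have L0 := L_gt0; have B0 := B_ge0.
pose D := B * expR (2 * L).
have D0 : 0 <= D by rewrite mulr_ge0 ?expR_ge0.
have Xs n t : 0 <= t <= 1 -> `|X n.+1 t - X n t| <= D * 2^-1 ^+ n.
  move=> t01; apply: le_trans (X_step n t01) _.
  apply: ler_wpM2r; first by rewrite exprn_ge0.
  apply: ler_wpM2l => //; rewrite ler_expR ler_piMr//.
    by rewrite mulr_ge0// ltW.
  by case/andP: t01.
(* The steps from the [n]-th iterate on sum to at most [2 * D * 2^-1 ^+ n]. Hence [a t] increases,
   [b t] decreases, and the supremum of [a t] is a limit with this explicit rate. *)
pose a t n := X n t - 2 * D * 2^-1 ^+ n.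
pose b t n := X n t + 2 * D * 2^-1 ^+ n.
pose f t := sup (range (a t)).
have an t : 0 <= t <= 1 -> {homo a t : n m / (n <= m)%N >-> n <= m}.
  move=> t01; apply/nondecreasing_seqP => n; rewrite /a exprS.
  by have := Xs n t t01; rewrite ler_norml => /andP[]; lra.
have bn t : 0 <= t <= 1 -> {homo b t : n m / (n <= m)%N >-> m <= n}.
  move=> t01; apply/nonincreasing_seqP => n; rewrite /b exprS.
  by have := Xs n t t01; rewrite ler_norml => /andP[]; lra.
have ab t n m : 0 <= t <= 1 -> a t n <= b t m.
  move=> t01; apply: le_trans (an t t01 n (maxn n m) (leq_maxl _ _)) _.
  apply: le_trans (bn t t01 m (maxn n m) (leq_maxr _ _)).
  have : 0 <= 2 * D * 2^-1 ^+ maxn n m by rewrite !mulr_ge0 ?exprn_ge0.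
  rewrite /a /b; lra.
have fX n t : 0 <= t <= 1 -> `|f t - X n t| <= 2 * D * 2^-1 ^+ n.
  move=> t01; have h1 : a t n <= f t.
    apply: ub_le_sup; last by exists n.
    by exists (b t 0%N) => _ [k _ <-]; exact: ab.
  have h2 : f t <= b t n.
    apply: ge_sup; first by exists (a t 0%N), 0%N.
    by move=> _ [k _ <-]; exact: ab.
  by rewrite ler_norml; apply/andP; rewrite /a /b in h1 h2; split; lra.
have fc : {within `[0, 1], continuous f}.
  apply: (@within_continuous_uniform_approx f (2 * D)); first by rewrite mulr_ge0.
  by move=> n; exists (X n) => // t; exact: fX.
exists f => // t t01; have /andP[t0 t1] := t01.
apply/eqP; rewrite -subr_eq0 -normr_le0; apply/ler_addgt0Pl => e e0; rewrite addr0.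
pose C := D + L * (2 * D).
have C0 : 0 <= C by rewrite addr_ge0// !mulr_ge0// ltW.
have bound n : `|f t - (g t + \int[mu]_(s in `[0, t]) phi s (f s))| <= C * 2^-1 ^+ n.
  have h1 := fX n.+1 t t01.
  have h2 : `|\int[mu]_(s in `[0, t]) phi s (X n s) -
              \int[mu]_(s in `[0, t]) phi s (f s)| <= L * (2 * D) * 2^-1 ^+ n.
    have cc : {within `[0, 1], continuous (fun _ : R => L * (2 * D) * 2^-1 ^+ n)}.
      by apply: continuous_subspaceT => x; exact: cvg_cst.
    apply: le_trans (le_dist_Rintegral t1 (phi_cont (@Xc n)) (phi_cont fc) cc _) _.
      move=> s /andP[s0 st]; have s01 : 0 <= s <= 1 by rewrite s0 (le_trans st).
      apply: le_trans (phi_lip _ _ s01) _.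
      by rewrite -mulrA ler_pM2l// distrC fX.
    rewrite Rintegral_itv_cst// ler_piMr//.
    by apply: mulr_ge0; [rewrite !mulr_ge0// ltW | rewrite exprn_ge0].
  have -> : f t - (g t + \int[mu]_(s in `[0, t]) phi s (f s)) =
     (f t - X n.+1 t) + (\int[mu]_(s in `[0, t]) phi s (X n s) -
              \int[mu]_(s in `[0, t]) phi s (f s)).
    by rewrite (XS n t); ring.
  apply: le_trans (ler_normD _ _) _; rewrite /C mulrDl; apply: lerD => //.
  by apply: le_trans h1 _; rewrite exprS; lra.
have [n /ltW ne] := geometric_half_lt C0 e0.
exact: le_trans (bound n) ne.
Qed.

End picard.

(** * Existence of a solution and of a root *)

Section existence.
Context (R : realType) (c kappa : R).
Hypotheses (c_gt0 : 0 < c) (kappa_gt0 : 0 < kappa).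

Let clip (x : R) : R := Num.max (-1) (Num.min 1 x).

Let clip_bnd x : -1 <= clip x <= 1.
Proof.
by rewrite /clip le_max lexx/= ge_max ge_min lexx/= andbT; lra.
Qed.

Let clip_id x : -1 <= x <= 1 -> clip x = x.
Proof. by move=> /andP[x1 x2]; rewrite /clip min_r// max_r. Qed.

Let clip_lip x y : `|clip x - clip y| <= `|x - y|.
Proof.
rewrite /clip ler_norml; have := ler_norm (x - y); have := lerNnormlW (lexx `|x - y|).
by case: (leP 1 x) => hx; case: (leP 1 y) => hy;
  [case: (leP (-1) 1) => h0 | case: (leP (-1) 1) => h0; case: (leP (-1) y) => hy'
  | case: (leP (-1) 1) => h0; case: (leP (-1) x) => hx'
  | case: (leP (-1) x) => hx'; case: (leP (-1) y) => hy' ] => h1 h2; apply/andP; split; lra.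
Qed.

Let within_continuous_clip (f : R -> R) :
  {within `[0, 1], continuous f} -> {within `[0, 1], continuous (fun s => clip (f s))}.
Proof.
move=> fc; have clipc : continuous clip.
  move=> x; apply: (@continuous_max R R (fun=> -1) (fun x => Num.min 1 x)).
    exact: cvg_cst.
  apply: (@continuous_min R R (fun=> 1) (fun x => x)).
    exact: cvg_cst.
  exact: cvg_id.
by move=> x; exact: (continuous_cvg _ (clipc (f x)) (fc x)).
Qed.

Let phi (s x : R) := expR (- (c / kappa * clip x * (clip x + s + kappa - 1))).

Let E (s x : R) := - (c / kappa * clip x * (clip x + s + kappa - 1)).

Let B := c / kappa * (kappa + 3).

Let ck_gt0 : 0 < c / kappa. Proof. by rewrite divr_gt0. Qed.

Let E_le s x : 0 <= s <= 1 -> E s x <= B.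
Proof.
move=> /andP[s0 s1]; have /andP[p1 p2] := clip_bnd x; have k0 := kappa_gt0.
rewrite /E /B -mulrA -mulrN ler_pM2l//; nra.
Qed.

Let E_lip s x y : 0 <= s <= 1 -> `|E s x - E s y| <= B * `|x - y|.
Proof.
move=> /andP[s0 s1]; have /andP[p1 p2] := clip_bnd x.
have /andP[p3 p4] := clip_bnd y; have k0 := kappa_gt0.
rewrite /E /B (_ : _ - _ = c / kappa *
  ((clip y - clip x) * (clip x + clip y + s + kappa - 1))); last by ring.
rewrite normrM (gtr0_norm ck_gt0) -mulrA ler_pM2l// normrM mulrC.
apply: ler_pM => //; last by rewrite distrC.
by rewrite ler_norml; apply/andP; split; lra.
Qed.

Let phi_bnd s x : 0 <= s <= 1 -> `|phi s x| <= expR B.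
Proof. by move=> s01; rewrite ger0_norm ?expR_ge0// ler_expR E_le. Qed.

Let phi_lip s x y : 0 <= s <= 1 -> `|phi s x - phi s y| <= expR B * B * `|x - y|.
Proof.
(* Factoring out [expR B] makes the remaining exponent nonpositive, where the exponential is
   1-Lipschitz. *)
move=> s01; have e z : phi s z = expR B * expR (- (B - E s z)).
  by rewrite -expRD /phi -/(E s z); congr expR; ring.
rewrite !e -mulrBr normrM (gtr0_norm (expR_gt0 _)) -mulrA ler_pM2l ?expR_gt0//.
apply: le_trans (expRN_lipschitz _ _) _; rewrite ?subr_ge0 ?E_le//.
rewrite (_ : _ - _ = E s y - E s x); last by ring.
by rewrite distrC; exact: E_lip.
Qed.

Let phi_cont (f : R -> R) : {within `[0, 1], continuous f} ->
  {within `[0, 1], continuous (fun s => phi s (f s))}.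
Proof.
by move=> fc; apply: within_continuous_expR_quadratic; exact: within_continuous_clip.
Qed.

(* Clipping the unknown to [-1, 1] makes the equation globally Lipschitz, and
   the clipped solution stays in [-1, 1]. *)
Lemma solution_exists : exists N, is_solution c kappa N.
Proof.
have k0 := kappa_gt0.
have gc : {within `[0, 1], continuous (fun t : R => 1 - 2 * t)}.
  apply: continuous_subspaceT => x; apply: cvgB; first exact: cvg_cst.
  by apply: cvgMr; exact: cvg_id.
have L0 : 0 < expR B * B.
  by rewrite mulr_gt0 ?expR_gt0// mulr_gt0// addr_gt0.
have [N Nc NE] := picard L0 gc phi_cont phi_lip phi_bnd.
have N0 : N 0 = 1 by rewrite NE ?lexx ?ler01// set_itv1 Rintegral_set1; ring.
have Nge t : 0 <= t <= 1 -> -1 <= N t.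
  move=> t01; rewrite NE//.
  have : 0 <= \int[lebesgue_measure]_(s in `[0, t]) phi s (N s).
    by apply: Rintegral_ge0 => s _; exact: expR_ge0.
  by case/andP: t01; lra.
have Nle t : 0 <= t <= 1 -> N t <= 1.
  move=> /andP[t0 t1]; rewrite -subr_ge0.
  (* Above 1 the clipped value is 1, so the exponential is at most 1 and [N] has slope at most -1:
     it cannot leave through the top. *)
  apply: (@barrier R (fun x => 1 - N x) (fun x => 0 - (- 2 + phi x (N x))) 0 t 1 t0 ltr01).
  - apply: (@within_continuousB _ _ _ `[0, t]%classic (fun _ : R => 1 : R) N).
      by move=> x; exact: cvg_cst.
    by apply: continuous_subspaceW Nc => x /=; rewrite !in_itv/= => /andP[-> /le_trans]; apply.
  - move=> x; rewrite in_itv/= => /andP[tx xt].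
    apply: (is_deriveB (is_derive_cst (1 : R) x 1)).
    apply: (integral_equation_is_derive (phi_cont Nc) NE).
    by rewrite in_itv/=; apply/andP; split; lra.
  - by rewrite N0 subrr.
  - move=> x; rewrite in_itv/= => /andP[tx xt] /andP[_ h].
    suff : phi x (N x) <= 1 by lra.
    have -> : phi x (N x) = expR (- (c / kappa * (x + kappa))).
      rewrite /phi /clip min_l ?max_r; [congr expR; ring|lra..].
    by rewrite expR_le1 oppr_le0 mulr_ge0// ?(ltW ck_gt0)//; lra.
exists N; split=> // t t01; rewrite NE//; congr (_ + _).
apply: eq_Rintegral => s; rewrite inE/= in_itv/= => /andP[s0 st].
have s01 : 0 <= s <= 1 by case/andP: t01 => _ t1; rewrite s0 (le_trans st).
by rewrite /phi clip_id// Nge// Nle.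
Qed.

(** If [N] stayed positive, [matched N] would be nonnegative up to time 1, where it equals [- N 1].
    So [N] reaches a nonpositive value, and it starts at 1. *)
Lemma solution_has_root N : is_solution c kappa N ->
  exists2 tau0, 0 <= tau0 <= 1 & N tau0 = 0.
Proof.
move=> solN; have N0 := solution0 solN.
have [[t [t01 Nt]]|H] := pselect (exists t, 0 <= t <= 1 /\ N t <= 0).
  have /andP[t0 t1] := t01.
  have Nc := solution_within_continuous solN (lexx 0) t1.
  have [|s] := IVT t0 Nc (v := 0).
    by rewrite N0 ge_min Nt orbT le_max ler01.
  rewrite in_itv/= => /andP[s0 st] Ns; exists s => //.
  by rewrite s0 (le_trans st).
have Ngt t : 0 <= t <= 1 -> 0 <= N t.
  by move=> t01; rewrite leNgt; apply/negP => Nt; apply: H; exists t; rewrite t01 ltW.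
have := matched_ge0 c_gt0 kappa_gt0 solN (lexx 1) Ngt.
move=> /(_ 1); rewrite lexx ler01 => /(_ isT); rewrite /matched subrr sub0r oppr_ge0 => N1.
by case: H; exists 1; rewrite lexx ler01.
Qed.

End existence.

(** * Means over independent labels *)

Section product_weights.
Context (R : realType) (I L : finType) (w : I -> L -> R).
Hypothesis w_total : forall i, \sum_a w i a = 1.
Implicit Types (x y : {ffun I -> L}) (X Y : {ffun I -> L} -> R).

Definition pmean X : R := \sum_(x : {ffun I -> L}) (\prod_i w i (x i)) * X x.

Lemma pmean_prod (f : I -> L -> R) :
  pmean (fun x => \prod_i f i (x i)) = \prod_i \sum_a w i a * f i a.
Proof.
by rewrite bigA_distr_bigA; apply: eq_bigr => x _; rewrite -big_split.
Qed.

Lemma pmean_cst (z : R) : pmean (fun=> z) = z.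
Proof.
transitivity (z * \prod_i \sum_a w i a * 1).
  rewrite -(pmean_prod (fun _ _ => 1)) /pmean mulr_sumr; apply: eq_bigr => x _.
  by rewrite [X in z * (_ * X)]big1// mulr1 mulrC.
rewrite big1 ?mulr1// => i _; rewrite -[RHS](w_total i).
by apply: eq_bigr => a _; rewrite mulr1.
Qed.

Lemma eq_pmean X Y : X =1 Y -> pmean X = pmean Y.
Proof. by move=> XY; apply: eq_bigr => x _; rewrite XY. Qed.

Lemma pmeanD X Y : pmean (fun x => X x + Y x) = pmean X + pmean Y.
Proof. by rewrite /pmean -big_split; apply: eq_bigr => x _; rewrite mulrDr. Qed.

Lemma pmeanZr X (z : R) : pmean (fun x => X x * z) = pmean X * z.
Proof. by rewrite /pmean mulr_suml; apply: eq_bigr => x _; rewrite mulrA. Qed.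

Lemma pmean_sum (T : finType) (P : pred T) (X : T -> {ffun I -> L} -> R) :
  pmean (fun x => \sum_(t | P t) X t x) = \sum_(t | P t) pmean (X t).
Proof.
rewrite /pmean exchange_big; apply: eq_bigr => x _.
by rewrite mulr_sumr.
Qed.

(* Two independent copies [x] and [y] may exchange their coordinates in [S]. *)
Lemma pmean_indep (S : pred I) X Y :
  (forall x y, (forall i, S i -> x i = y i) -> X x = X y) ->
  (forall x y, (forall i, ~~ S i -> x i = y i) -> Y x = Y y) ->
  pmean (fun x => X x * Y x) = pmean X * pmean Y.
Proof.
move=> XS YS.
pose mix x y : {ffun I -> L} := [ffun i => if S i then x i else y i].
pose P x := \prod_i w i (x i).
have mixP x y : P (mix x y) * P (mix y x) = P x * P y.
  rewrite /P -!big_split; apply: eq_bigr => i _ /=; rewrite !ffunE.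
  by case: ifP => // _; rewrite mulrC.
transitivity (\sum_(z : {ffun I -> L} * {ffun I -> L}) P z.1 * P z.2 * (X z.1 * Y z.1)).
  rewrite -(pair_big predT predT (fun x y => P x * P y * (X x * Y x)))/=.
  apply: eq_bigr => x _; rewrite -mulr_suml -mulr_sumr -/(P x).
  have := pmean_cst 1; rewrite /pmean.
  under eq_bigr do rewrite mulr1.
  by move=> ->; rewrite mulr1.
have -> : pmean X * pmean Y =
    \sum_(z : {ffun I -> L} * {ffun I -> L}) P z.1 * P z.2 * (X z.1 * Y z.2).
  rewrite -(pair_big predT predT (fun x y => P x * P y * (X x * Y y)))/=.
  rewrite /pmean mulr_suml; apply: eq_bigr => x _; rewrite mulr_sumr.
  by apply: eq_bigr => y _; rewrite -/(P x) -/(P y) mulrACA.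
pose h (z : {ffun I -> L} * {ffun I -> L}) := (mix z.1 z.2, mix z.2 z.1).
have hK : involutive h.
  by case=> x y; congr pair; apply/ffunP => i; rewrite !ffunE /=; case E: (S i); rewrite ?ffunE ?E.
rewrite [RHS](reindex_inj (inv_inj hK))/=; apply: eq_bigr => -[x y] _ /=.
rewrite mixP; congr (_ * (_ * _)).
  by apply: XS => i Si; rewrite ffunE Si.
by apply: YS => i Si; rewrite ffunE (negbTE Si).
Qed.

End product_weights.

(** * Expectations under finite laws *)

Section expectation.
Context (R : realType).

Definition expect (T : finType) (p : law R T) (h : T -> R) : R := \sum_x p x * h x.

Lemma expect_dret (T : finType) (x : T) h : expect (dret R x) h = h x.
Proof.
rewrite /expect /dret (bigD1 x)//= eqxx mul1r big1 ?addr0// => y /negbTE ->.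
by rewrite mul0r.
Qed.

Lemma expect_dbind (S T : finType) (p : law R S) (k : S -> law R T) h :
  expect (dbind p k) h = expect p (fun x => expect (k x) h).
Proof.
rewrite /expect /dbind; under eq_bigr do rewrite mulr_suml.
rewrite exchange_big; apply: eq_bigr => x _ /=.
by rewrite mulr_sumr; apply: eq_bigr => y _; rewrite mulrA.
Qed.

Lemma expect_unif (T : finType) (A : {set T}) h :
  expect (unif R A) h = (\sum_(x in A) h x) / #|A|%:R.
Proof.
rewrite /expect /unif mulr_suml [RHS]big_mkcond; apply: eq_bigr => x _.
by case: (x \in A); rewrite ?mul0r// mul1r mulrC.
Qed.

Lemma expect_pred (T : finType) (p : law R T) (A : pred T) :
  Pr p A = expect p (fun x => (A x)%:R).
Proof.
rewrite /Pr big_mkcond; apply: eq_bigr => x _.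
by case: (A x); rewrite ?mulr1 ?mulr0.
Qed.

Lemma unif_ge0 (T : finType) (A : {set T}) x : 0 <= unif R A x.
Proof. by rewrite divr_ge0 ?ler0n. Qed.

End expectation.

(** A run reads colours of current edges only; this makes its continuation independent of the labels
    of deleted pairs. *)
Lemma modified_greedy_col (R : realType) (n q : nat)
    (c1 c2 : {ffun {set 'I_n} -> 'I_q}) k (V : {set 'I_n}) (E M M' : {set {set 'I_n}}) :
  {in E, c1 =1 c2} ->
  modified_greedy R c1 k V E M M' = modified_greedy R c2 k V E M M'.
Proof.
elim: k V E M => //= k IH V E M cE; case: ifP => // _.
apply: eq_bigr => v _; congr (_ * _); case: ifP => _; first exact: IH.
apply: eq_bigr => u _; rewrite /unif; case: (boolP (u \in _)) => [uN|]; last by rewrite !mul0r.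
move: uN; rewrite inE => uE; congr (_ * _); rewrite IH.
  congr (modified_greedy _ _ _ _ _ _ _); apply/setP => f; rewrite !inE.
  by case: (boolP (f \in E)) => //= fE; rewrite !cE.
by move=> f; rewrite inE => /andP[/cE].
Qed.

(** * Reduction of the process on the binomial graph to a chain *)

Section lumping.
Context (R : realType) (n q : nat) (p : R) (g : nat -> R).

Notation vertex := 'I_n.
Notation outcome := {ffun {set 'I_n} -> bool * 'I_q}.
Implicit Types (x y : outcome) (V : {set 'I_n}) (C : {set 'I_q}) (M : {set {set 'I_n}}).

(* The label of a pair of vertices is its presence in the binomial random graph
   together with its colour. *)
Definition pair_weight (e : {set 'I_n}) (l : bool * 'I_q) : R :=
  (if #|e| == 2%N then (if l.1 then p else 1 - p) else (~~ l.1)%:R) / q%:R.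

Definition outcome_col x : {ffun {set 'I_n} -> 'I_q} := [ffun e => (x e).2].

Definition usable V C (e : {set 'I_n}) (l : bool * 'I_q) : bool :=
  [&& l.1, #|e| == 2%N, e \subset V & l.2 \notin C].

(* What is left of the graph when the vertices [V] survive and the colours [C]
   are used up. *)
Definition residual x V C : {set {set 'I_n}} := [set e | usable V C e (x e)]%SET.

Definition greedy_mean k x V C M : R :=
  expect (modified_greedy R (outcome_col x) k V (residual x V C) M)
         (fun M' => g #|M'|).

(* The chain of the number [j] of chosen edges, with [k] rounds to go: [k - j]
   vertices survive after the round and [q - j] colours are unused. *)
Definition stay k j : R := (1 - p * ((q - j)%:R / q%:R)) ^+ (k - j).

Fixpoint chain k j : R :=
  if k is k'.+1 then stay k' j * chain k' j + (1 - stay k' j) * chain k' j.+1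
  else g j.

(** Here [k - j] is 0 and [stay] is an empty product, equal to 1: with no vertex left, the remaining
    rounds are idle. *)
Lemma chain_small k j : (k <= j)%N -> chain k j = g j.
Proof.
elim: k j => //= k IH j kj; rewrite /stay (eqP (ltnW kj : k - j == 0)%N) expr0 subrr.
by rewrite mul1r mul0r addr0 IH// ltnW.
Qed.

(** The principle of deferred decisions: the continuation does not depend on the labels of pairs
    that have lost a vertex. *)
Lemma greedy_mean_local k x y V C M :
  (forall e : {set 'I_n}, e \subset V -> x e = y e) ->
  greedy_mean k x V C M = greedy_mean k y V C M.
Proof.
move=> xy; rewrite /greedy_mean.
have -> : residual y V C = residual x V C.
  apply/setP => e; rewrite !inE /usable; case: (boolP (e \subset V)) => [/xy->//|].
  by rewrite !andbF.
apply: eq_bigr => M' _; congr (_ * _); apply: modified_greedy_col => e.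
by rewrite inE => /and4P[_ _ /xy eV _]; rewrite !ffunE eV.
Qed.

Lemma mem_neighbors_residual x V C u v :
  (u \in neighbors (residual x V C) v) = usable V C [set u; v]%SET (x [set u; v]%SET).
Proof. by rewrite !inE. Qed.

Lemma usable_neq V C u v l : usable V C [set u; v]%SET l ->
  [/\ u != v, u \in V & v \in V].
Proof.
case/and4P=> _; rewrite cards2; case: (eqVneq u v) => //= _ _ /fintype.subsetP sV _.
by split=> //; apply: sV; rewrite !inE eqxx ?orbT.
Qed.

Lemma residual_isolated x V C v : neighbors (residual x V C) v == finset.set0 ->
  residual x (V :\ v)%SET C = residual x V C.
Proof.
move=> /eqP N0; apply/setP => e; rewrite !inE /usable subsetD1.
case: (boolP (v \in e)) => [ve|]; last by rewrite andbT.
rewrite /= ?(andbF, andFb, andbT); apply/esym/negP => /and4P[e1 e2 eV eC].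
have /cards2P[a [b [ab eE]]] := e2.
have [u eu] : exists u, e = [set u; v]%SET.
  move: ve; rewrite eE !inE => /orP[] /eqP ->; first by exists b; rewrite finset.setUC.
  by exists a.
have : u \in neighbors (residual x V C) v.
  by rewrite mem_neighbors_residual -eu /usable e1 e2 eV.
by rewrite N0 inE.
Qed.

Lemma residual_match x V C (e : {set 'I_n}) :
  [set f in residual x V C | [disjoint f & e] &&
     (outcome_col x f != outcome_col x e)]%SET =
  residual x (V :\: e)%SET ((x e).2 |: C)%SET.
Proof.
apply/setP => f; rewrite !inE /usable subsetD !inE negb_or !ffunE.
by do !case: (_ \in _) || case: (_ \subset _) || case: [disjoint _ & _]; rewrite ?andbT ?andbF// ?andbA//;
  do !case: (_ == _).
Qed.

Lemma greedy_mean_no_edge k x V C M : residual x V C = finset.set0 ->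
  greedy_mean k x V C M = g #|M|.
Proof. by rewrite /greedy_mean => ->; case: k => [|k] /=; rewrite ?eqxx expect_dret. Qed.

(** The algorithm stops at an edgeless graph, while the recursion goes on deleting isolated
    vertices. Both give [g #|M|], so the round count can be kept in step with the number of
    survivors. *)
Lemma greedy_mean_rec k x V C M : V != finset.set0 ->
  greedy_mean k.+1 x V C M =
  (\sum_(v in V) (if neighbors (residual x V C) v == finset.set0
      then greedy_mean k x (V :\ v)%SET C M
      else (\sum_(u in neighbors (residual x V C) v)
         greedy_mean k x (V :\: [set u; v])%SET ((x [set u; v]%SET).2 |: C)%SET
           ([set u; v] |: M)%SET) / #|neighbors (residual x V C) v|%:R)) / #|V|%:R.
Proof.
move=> V0; have cV : #|V|%:R != 0 :> R by rewrite pnatr_eq0 cards_eq0.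
case: (eqVneq (residual x V C) finset.set0) => E0.
  rewrite greedy_mean_no_edge// [X in X / _](_ : _ = #|V|%:R * g #|M|).
    by rewrite mulrAC divff// mul1r.
  rewrite mulr_natl -sumr_const; apply: eq_bigr => v _.
  have N0 : neighbors (residual x V C) v == finset.set0.
    by apply/eqP/setP => u; rewrite E0 !inE.
  by rewrite N0 greedy_mean_no_edge// residual_isolated.
rewrite {1}/greedy_mean /= (negbTE E0) expect_dbind expect_unif.
congr (_ / _); apply: eq_bigr => v vV; case: ifP => N0.
  by rewrite /greedy_mean residual_isolated.
rewrite expect_dbind expect_unif; congr (_ / _); apply: eq_bigr => u uN.
by rewrite /greedy_mean -residual_match.
Qed.

End lumping.

Section lumping_mean.
Context (R : realType) (n q : nat) (p : R) (g : nat -> R).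
Hypothesis q_gt0 : (0 < q)%N.

Notation outcome := {ffun {set 'I_n} -> bool * 'I_q}.
Implicit Types (x y : outcome) (V : {set 'I_n}) (C : {set 'I_q}) (M : {set {set 'I_n}}).

Let qR : q%:R != 0 :> R. Proof. by rewrite pnatr_eq0 -lt0n. Qed.

Lemma sum_pair_weight (e : {set 'I_n}) (h : bool -> 'I_q -> R) :
  \sum_(l : bool * 'I_q) pair_weight p e l * h l.1 l.2 =
  \sum_(b : bool) (if #|e| == 2%N then (if b then p else 1 - p) else (~~ b)%:R) *
     ((\sum_a h b a) / q%:R).
Proof.
rewrite -(pair_bigA _ (fun b a => pair_weight p e (b, a) * h b a))/=.
apply: eq_bigr => b _; rewrite mulr_suml mulr_sumr; apply: eq_bigr => a _.
by rewrite /pair_weight /= mulrAC mulrA.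
Qed.

Lemma pair_weight_total (e : {set 'I_n}) : \sum_(l : bool * 'I_q) pair_weight p e l = 1.
Proof.
under eq_bigr do rewrite -[pair_weight _ _ _]mulr1.
rewrite (sum_pair_weight e (fun _ _ => 1)) big_bool/= sumr_const card_ord divff// !mulr1.
by case: ifP => _; rewrite ?add0r// addrC subrK.
Qed.

Lemma usable_prob V C (e : {set 'I_n}) : e \subset V -> #|e| = 2%N ->
  \sum_(l : bool * 'I_q) pair_weight p e l * (~~ usable V C e l)%:R =
  1 - p * ((q - #|C|)%:R / q%:R).
Proof.
move=> eV e2; pose h b a : R := (~~ (b && (a \notin C)))%:R.
transitivity (\sum_(l : bool * 'I_q) pair_weight p e l * h l.1 l.2).
  by apply: eq_bigr => -[b a] _; rewrite /usable e2 eV.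
rewrite sum_pair_weight e2 /= big_bool/= /h /=.
rewrite [X in (1 - p) * (X / _)](_ : _ = q%:R); last by rewrite sumr_const card_ord.
rewrite [X in p * (X / _) + _](_ : _ = q%:R - (q - #|C|)%:R).
  by move: (q - #|C|)%:R => z; field; exact: qR.
transitivity (\sum_a ((a \in C)%:R : R)); first by apply: eq_bigr => a _; rewrite negbK.
have Cq : (#|C| <= q)%N by rewrite -[leqRHS]card_ord max_card.
rewrite natrB// subKr -sum1_card natr_sum [RHS]big_mkcond/=.
by apply: eq_bigr => a _; case: (a \in C).
Qed.

(** Being isolated is a product of independent conditions over the [#|V|.-1] pairs joining [v] to
    the other survivors, and the mean of such a product factorises. *)
Lemma isolated_prob V C v : v \in V ->
  pmean (pair_weight p) (fun x => (neighbors (residual x V C) v == finset.set0)%:R) =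
  (1 - p * ((q - #|C|)%:R / q%:R)) ^+ #|V|.-1.
Proof.
move=> vV; pose S := [set [set u; v]%SET | u in (V :\ v)%SET]%SET.
pose f (e : {set 'I_n}) l : R := if e \in S then (~~ usable V C e l)%:R else 1.
have SV e : e \in S -> e \subset V /\ #|e| = 2%N.
  case/imsetP => u; rewrite !inE => /andP[uv uV] ->; split.
    by apply/fintype.subsetP => z; rewrite !inE => /orP[] /eqP ->.
  by rewrite cards2 uv.
transitivity (pmean (pair_weight p) (fun x => \prod_e f e (x e))).
  apply: eq_pmean => x; case: eqP => [N0|/eqP/set0Pn[u uN]].
    rewrite big1// => e _; rewrite /f; case: ifP => // /imsetP[u _ eE].
    suff -> : usable V C e (x e) = false by [].
    by rewrite eE -mem_neighbors_residual N0 inE.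
  have [uv uV _] : [/\ u != v, u \in V & v \in V].
    by move: uN; rewrite mem_neighbors_residual => /usable_neq.
  rewrite (bigD1 [set u; v]%SET)//= /f ifT; last first.
    by apply/imsetP; exists u => //; rewrite !inE uv.
  by rewrite -mem_neighbors_residual uN mul0r.
rewrite pmean_prod; transitivity (\prod_(e in S) (1 - p * ((q - #|C|)%:R / q%:R))).
  rewrite [RHS]big_mkcond/=; apply: eq_bigr => e _; rewrite /f; case: ifP => eS.
    by have [eV e2] := SV e eS; rewrite usable_prob.
  by under eq_bigr do rewrite mulr1; rewrite pair_weight_total.
rewrite prodr_const card_in_imset; first by rewrite [in RHS](cardsD1 v) vV.
move=> u1 u2; rewrite !inE => /andP[u1v _] /andP[u2v _] /setP/(_ u1).
by rewrite !inE eqxx (negbTE u1v) !orbF => /esym/eqP.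
Qed.

(** For a fixed chosen vertex [v], its neighbourhood depends on labels of pairs containing [v] and
    the continuation on the other labels, so the mean factorises. By induction the continuation
    depends on [V], [C] and [M] only through their sizes. No edge of [M] lies inside [V], hence each
    new edge really increases [#|M|]. *)
Lemma pmean_greedy k V C M j : #|V| = (k - j)%N -> #|C| = j -> #|M| = j ->
  (forall f, f \in M -> ~~ (f \subset V)) ->
  pmean (pair_weight p) (fun x => greedy_mean g k x V C M) = chain q p g k j.
Proof.
have wt := pair_weight_total.
elim: k V C M j => [|k IH] V C M j Vj Cj Mj MV.
  rewrite (@eq_pmean _ _ _ _ _ (fun=> g j)) ?pmean_cst// => x.
  by rewrite /greedy_mean /= expect_dret Mj.
have [V0|V0] := eqVneq V finset.set0.
  rewrite chain_small; last by rewrite -subn_eq0 -Vj V0 cards0.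
  rewrite (@eq_pmean _ _ _ _ _ (fun=> g j)) ?pmean_cst// => x.
  rewrite greedy_mean_no_edge ?Mj//; apply/setP => e; rewrite !inE V0.
  apply/negP => /and4P[_ e2 e0 _]; rewrite finset.subset0 in e0.
  by rewrite (eqP e0) cards0 in e2.
have jk : (j <= k)%N.
  by rewrite -ltnS -subn_gt0 -Vj lt0n cards_eq0.
rewrite (@eq_pmean _ _ _ _ _ _ (fun x => @greedy_mean_rec R n q g k x V C M V0)).
rewrite pmeanZr pmean_sum.
rewrite (eq_bigr (fun=> chain q p g k.+1 j)); last first.
  move=> v vV.
  pose N x := neighbors (residual x V C) v.
  pose W u := (V :\: [set u; v])%SET.
  (* Splitting also over the colour [a] of the chosen edge makes the set of used colours
     deterministic; otherwise the continuation would still depend on a label at [v]. *)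
  transitivity (pmean (pair_weight p) (fun x =>
      (N x == finset.set0)%:R * greedy_mean g k x (V :\ v)%SET C M +
      \sum_(u in (V :\ v)%SET) \sum_(a in (~: C)%SET)
        ((u \in N x) && ((x [set u; v]%SET).2 == a))%:R / #|N x|%:R *
         greedy_mean g k x (W u) (a |: C)%SET ([set u; v] |: M)%SET)).
    apply: eq_pmean => x; rewrite -/(N x).
    case: ifP => N0.
      rewrite mul1r big1 ?addr0// => u _; rewrite big1// => a _.
      by rewrite (eqP N0) inE !mul0r.
    rewrite mul0r add0r mulr_suml [LHS]big_mkcond [RHS]big_mkcond; apply: eq_bigr => u _.
    case: (boolP (u \in N x)) => uN; last first.
      by case: ifP => // _; rewrite big1// => a _; rewrite !mul0r.
    have us : usable V C [set u; v]%SET (x [set u; v]%SET).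
      by rewrite -mem_neighbors_residual.
    have [uv uV _] := usable_neq us; rewrite !inE uv uV /=.
    rewrite (bigD1 (x [set u; v]%SET).2)/=; last by case/and4P: us; rewrite inE.
    rewrite eqxx big1 ?addr0; first by rewrite mulrC mul1r.
    by move=> a /andP[_ /negbTE]; rewrite eq_sym => ->; rewrite !mul0r.
  have Nloc x y : (forall e : {set 'I_n}, v \in e -> x e = y e) -> N x = N y.
    move=> xy; apply/setP => u; rewrite !mem_neighbors_residual xy// !inE eqxx orbT//.
  have Vv : #|(V :\ v)%SET| = (k - j)%N.
    by have := cardsD1 v V; rewrite vV Vj subSn// => -[].
  rewrite pmeanD (pmean_indep wt (S := fun e => v \in e)); first last.
  - move=> x y xy; apply: greedy_mean_local => e; rewrite subsetD1 => /andP[_ ve].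
    exact: xy.
  - by move=> x y /Nloc ->.
  rewrite (IH _ _ _ j)//; last first.
    by move=> f /MV; apply: contra => /fintype.subset_trans; apply; exact: subD1set.
  rewrite isolated_prob// Cj Vj subSn//= -/(stay q p k j); congr (_ + _).
  rewrite pmean_sum.
  transitivity (\sum_(u in (V :\ v)%SET) \sum_(a in (~: C)%SET)
     pmean (pair_weight p) (fun x => ((u \in N x) && ((x [set u; v]%SET).2 == a))%:R / #|N x|%:R)
     * chain q p g k j.+1).
    apply: eq_bigr => u; rewrite !inE => /andP[uv uV]; rewrite pmean_sum.
    apply: eq_bigr => a; rewrite inE => aC.
    rewrite (pmean_indep wt (S := fun e => v \in e)); first last.
    - move=> x y xy; apply: greedy_mean_local => e; rewrite subsetD => /andP[_ ed].
      apply: xy; rewrite /= (disjointFl ed)//.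
      by rewrite !inE eqxx orbT.
    - by move=> x y xy; rewrite (Nloc _ _ xy) xy// !inE eqxx orbT.
    congr (_ * _); apply: IH.
    - rewrite /W cardsD (finset.setIidPr _) ?Vj ?cards2 ?uv/=; first by lia.
      by apply/fintype.subsetP => z; rewrite !inE => /orP[] /eqP ->.
    - by rewrite cardsU1 aC Cj.
    - rewrite cardsU1 Mj; suff -> : [set u; v]%SET \notin M by [].
      apply/negP => /MV/negP; apply.
      by apply/fintype.subsetP => z; rewrite !inE => /orP[] /eqP ->.
    - move=> f; rewrite !inE => /orP[/eqP ->|/MV].
        by apply/negP => /fintype.subsetP/(_ u); rewrite !inE eqxx => /(_ isT).
      by apply: contra => /fintype.subset_trans; apply; exact: subsetDl.
  under eq_bigr do rewrite -mulr_suml.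
  rewrite -mulr_suml; congr (_ * _).
  under eq_bigr do rewrite -pmean_sum.
  rewrite -pmean_sum.
  have <- : pmean (pair_weight p) (fun x => 1 - (N x == finset.set0)%:R) = 1 - stay q p k j.
    under eq_pmean do rewrite -[- _]mulrN1.
    rewrite pmeanD pmean_cst// pmeanZr isolated_prob// Cj Vj subSn//= mulrN1.
    by [].
  apply: eq_pmean => x.
  have [N0|N0] := eqVneq (N x) finset.set0.
    by rewrite subrr big1// => u _; rewrite big1// => a _; rewrite N0 inE mul0r.
  rewrite subr0; transitivity (\sum_(u in N x) (#|N x|%:R^-1 : R)); last first.
    by rewrite sumr_const -[LHS]mulr_natr mulVf// pnatr_eq0 cards_eq0.
  rewrite [LHS]big_mkcond [RHS]big_mkcond; apply: eq_bigr => u _.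
  case: (boolP (u \in N x)) => uN; last first.
    by case: ifP => // _; rewrite big1// => a _; rewrite mul0r.
  have us : usable V C [set u; v]%SET (x [set u; v]%SET).
    by rewrite -mem_neighbors_residual.
  have [uv uV _] := usable_neq us; rewrite !inE uv uV /=.
  rewrite (bigD1 (x [set u; v]%SET).2)/=; last by case/and4P: us; rewrite inE.
  rewrite eqxx big1 ?addr0; first by rewrite mul1r.
  by move=> a /andP[_ /negbTE]; rewrite eq_sym => ->; rewrite mul0r.
rewrite sumr_const -[_ *+ _]mulr_natr mulfK//.
by rewrite pnatr_eq0 cards_eq0.
Qed.

End lumping_mean.

(** * The mass of a binomial law at its mode *)

Section binomial.
Context (R : realType).
Implicit Types (p : R) (f : nat -> R).

Definition binom_mass p N k : R := 'C(N, k)%:R * p ^+ k * (1 - p) ^+ (N - k).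

Definition binom_mean p N f : R := \sum_(k < N.+1) binom_mass p N k * f k.

Lemma binom_meanS p N f : binom_mean p N.+1 f =
  (1 - p) * binom_mean p N f + p * binom_mean p N (fun k => f k.+1).
Proof.
rewrite /binom_mean !mulr_sumr.
transitivity (\sum_(k < N.+2) 'C(N, k)%:R * p ^+ k * (1 - p) ^+ (N.+1 - k) * f k +
   \sum_(i < N.+1) p * (binom_mass p N i * f i.+1)).
  rewrite [LHS]big_ord_recl [X in _ = X + _]big_ord_recl /= -addrA; congr (_ + _).
    by rewrite /binom_mass !bin0.
  rewrite -big_split; apply: eq_bigr => i _ /=.
  by rewrite /binom_mass /bump/= !add1n subSS binS natrD exprS; ring.
congr (_ + _); rewrite big_ord_recr /= bin_small// !mul0r addr0.
apply: eq_bigr => i _; rewrite /binom_mass subSn; last by rewrite -ltnS.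
by rewrite exprS; ring.
Qed.

Lemma binom_mean1 p N : binom_mean p N (fun=> 1) = 1.
Proof.
elim: N => [|N IH]; last by rewrite binom_meanS !IH; ring.
by rewrite /binom_mean big_ord1 /binom_mass bin0 expr0 !mulr1.
Qed.

(** Squared bias plus variance. The centre [a] is left free because conditioning on a success shifts
    it to [a - 1]. *)
Lemma binom_mean_sqr p N (a : R) :
  binom_mean p N (fun k => (k%:R - a) ^+ 2) =
  (N%:R * p - a) ^+ 2 + N%:R * p * (1 - p).
Proof.
elim: N a => [|N IH] a.
  by rewrite /binom_mean big_ord1 /binom_mass /= bin0 subnn !expr0; ring.
rewrite binom_meanS IH.
have -> : binom_mean p N (fun k => (k.+1%:R - a) ^+ 2) =
    binom_mean p N (fun k => (k%:R - (a - 1)) ^+ 2).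
  by apply: eq_bigr => i _; congr (_ * _); rewrite -[i.+1%:R]natr1; ring.
by rewrite IH -[N.+1%:R]natr1; ring.
Qed.

Context (N m : nat).
Hypotheses (m_gt0 : (0 < m)%N) (mN : (m < N)%N).

Let p : R := m%:R / N%:R.

Let NR : 0 < N%:R :> R. Proof. by rewrite ltr0n (leq_ltn_trans _ mN). Qed.
Let p_gt0 : 0 < p. Proof. by apply: divr_gt0 NR; rewrite ltr0n. Qed.
Let p_lt1 : 0 < 1 - p.
Proof. by rewrite subr_gt0 ltr_pdivrMr// mul1r ltr_nat. Qed.

Lemma binom_mass_ge0 k : 0 <= binom_mass p N k.
Proof. by rewrite !mulr_ge0 ?ler0n ?exprn_ge0// ltW. Qed.

Let step k : (k < N)%N ->
  binom_mass p N k.+1 * (k.+1%:R * (1 - p)) = binom_mass p N k * ((N%:R - k%:R) * p).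
Proof.
move=> kN; have := congr1 (fun z => z%:R : R) (mul_bin_left N k).
rewrite !natrM natrB ?(ltnW kN)// => E.
have -> : binom_mass p N k.+1 * (k.+1%:R * (1 - p)) =
   (k.+1%:R * 'C(N, k.+1)%:R) * p ^+ k.+1 * ((1 - p) ^+ (N - k.+1) * (1 - p)).
  by rewrite /binom_mass; ring.
rewrite E -exprSr -subSn// subSS /binom_mass exprS; ring.
Qed.

Let ratio k : ((N%:R - k%:R) * p <= k.+1%:R * (1 - p)) = (m <= k)%N.
Proof.
have -> : (N%:R - k%:R) * p = m%:R - k%:R * p by rewrite mulrBl /p mulrC divfK ?gt_eqF.
have -> : k.+1%:R * (1 - p) = k.+1%:R - p - k%:R * p :> R.
  by rewrite -[k.+1%:R]natr1; ring.
rewrite lerD2r; apply/idP/idP => [|mk].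
  rewrite leqNgt; apply: contraTN => km.
  rewrite -ltNge; apply: lt_le_trans (_ : k.+1%:R <= _); last by rewrite ler_nat.
  by rewrite ltrBlDr ltrDl.
have h : (m%:R <= k%:R :> R) by rewrite ler_nat.
have := p_lt1; rewrite -[k.+1%:R]natr1; lra.
Qed.

(** The ratio of consecutive masses passes 1 exactly at [m], since the mean [N * p] is the integer
    [m]. *)
Lemma binom_mass_le_mode k : (k <= N)%N -> binom_mass p N k <= binom_mass p N m.
Proof.
have pos j : 0 < j.+1%:R * (1 - p) by rewrite mulr_gt0 ?ltr0n.
have up j : (j < m)%N -> binom_mass p N j <= binom_mass p N j.+1.
  move=> jm; rewrite -(ler_pM2r (pos j)) step ?(ltn_trans jm)//.
  apply: ler_wpM2l; first exact: binom_mass_ge0.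
  by apply: ltW; rewrite ltNge ratio -ltnNge.
have down j : (m <= j < N)%N -> binom_mass p N j.+1 <= binom_mass p N j.
  move=> /andP[mj jN]; rewrite -(ler_pM2r (pos j)) step//.
  by apply: ler_wpM2l; [exact: binom_mass_ge0 | rewrite ratio].
have [km _|mk kN] := leqP k m.
  have H d : forall j, (j + d)%N = m -> binom_mass p N j <= binom_mass p N m.
    elim: d => [|d IH] j jE; first by rewrite -jE addn0.
    apply: le_trans (up j _) (IH j.+1 _); first by lia.
    by rewrite addSnnS.
  exact: H (subnKC km).
elim: k mk kN => // k IH; rewrite ltnS => mk kN.
apply: le_trans (down k _) _; first by rewrite mk.
by move: mk; rewrite leq_eqVlt => /predU1P[<-//|mk]; exact: IH mk (ltnW kN).
Qed.

Lemma card_near_le t : (#|[set k : 'I_N.+1 | (m <= k + t) && (k <= m + t)]%SET| <= t.*2.+1)%N.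
Proof.
rewrite cardE -(size_map val) -(size_iota (m - t) t.*2.+1); apply: uniq_leq_size.
  by rewrite map_inj_uniq ?enum_uniq//; exact: val_inj.
move=> k /mapP[i]; rewrite mem_enum inE => /andP[h1 h2] ->.
by rewrite mem_iota /=; lia.
Qed.

(* By Chebyshev's inequality the [2 t + 1] values around the mode carry half of
   the mass. *)
Lemma binom_mode_ge t : (m.*2 <= t ^ 2)%N ->
  1 / 2 <= t.*2.+1%:R * binom_mass p N m.
Proof.
move=> mt; have t0 : 0 < t%:R ^+ 2 :> R.
  by rewrite -natrX ltr0n; apply: leq_trans mt; rewrite double_gt0.
pose A := [set k : 'I_N.+1 | (m <= k + t)%N && (k <= m + t)%N]%SET.
have var : binom_mean p N (fun k => (k%:R - m%:R) ^+ 2) <= m%:R.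
  have Npm : N%:R * p = m%:R by rewrite mulrC divfK ?gt_eqF.
  rewrite binom_mean_sqr Npm subrr expr0n add0r ler_piMr// lerBlDr lerDl.
  exact: ltW p_gt0.
have h : 1 <= \sum_(k in A) binom_mass p N k +
    binom_mean p N (fun k => (k%:R - m%:R) ^+ 2) / t%:R ^+ 2.
  rewrite -[leLHS](binom_mean1 p N) [X in X + _]big_mkcond mulr_suml -big_split /=.
  apply: ler_sum => k _; have b0 := binom_mass_ge0 k.
  rewrite mulr1 inE; case: ifP => kA.
    by rewrite lerDl; apply: divr_ge0 (ltW t0); exact: mulr_ge0 b0 (sqr_ge0 _).
  rewrite add0r -mulrA ler_peMr// ler_pdivlMr// mul1r.
  rewrite -[leRHS]real_normK ?num_real// lerXn2r ?nnegrE ?ler0n//.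
  move/negbT: kA; rewrite negb_and -!ltnNge => /orP[] kA.
    rewrite ler0_norm ?subr_le0 ?ler_nat; last by lia.
    by rewrite opprB lerBrDr -natrD ler_nat addnC ltnW.
  rewrite ger0_norm ?subr_ge0 ?ler_nat; last by lia.
  by rewrite lerBrDr -natrD ler_nat addnC ltnW.
have hA : \sum_(k in A) binom_mass p N k <= t.*2.+1%:R * binom_mass p N m.
  apply: (@le_trans _ _ (\sum_(k in A) binom_mass p N m)).
    by apply: ler_sum => k _; apply: binom_mass_le_mode; rewrite -ltnS.
  rewrite sumr_const -[leLHS]mulr_natl; apply: ler_wpM2r; first exact: binom_mass_ge0.
  by rewrite ler_nat card_near_le.
have hv : binom_mean p N (fun k => (k%:R - m%:R) ^+ 2) / t%:R ^+ 2 <= 1 / 2.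
  rewrite ler_pdivrMr//; apply: le_trans var _.
  have : m.*2%:R <= t%:R ^+ 2 :> R by rewrite -natrX ler_nat.
  by rewrite -muln2 natrM; lra.
lra.
Qed.

End binomial.

(** * Passing from the binomial to the uniform random graph *)

Section transfer.
Context (R : realType) (n q m : nat) (p : R).
Hypotheses (q_gt0 : (0 < q)%N) (p_ge0 : 0 <= p) (p_le1 : p <= 1)
  (m_le : (m <= 'C(n, 2))%N).

Notation edges := {set {set 'I_n}}.
Notation coloring := {ffun {set 'I_n} -> 'I_q}.
Notation outcome := {ffun {set 'I_n} -> bool * 'I_q}.

Let pairs : edges := [set e : {set 'I_n} | #|e| == 2%N]%SET.

Let graphs : {set edges} :=
  [set E : edges | (#|E| == m) && [forall e in E, #|e| == 2%N]]%SET.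

Let card_pairs : #|pairs| = 'C(n, 2).
Proof. by rewrite card_draws card_ord. Qed.

Let graphsE : graphs = [set E : edges | E \subset pairs & #|E| == m]%SET.
Proof.
apply/setP => E; rewrite !inE andbC; congr (_ && _).
apply/forall_inP/fintype.subsetP => H e eE; first by rewrite inE; exact: H.
by have := H e eE; rewrite inE.
Qed.

Let card_graphs : #|graphs| = 'C('C(n, 2), m).
Proof. by rewrite graphsE cards_draws card_pairs. Qed.

Let outcome_of (Ec : edges * coloring) : outcome :=
  [ffun e => (e \in Ec.1, Ec.2 e)].

Let outcome_of_bij : bijective outcome_of.
Proof.
exists (fun x : outcome => ([set e : {set 'I_n} | (x e).1]%SET, outcome_col x)).
  case=> E col; congr pair; first by apply/setP => e; rewrite inE ffunE.
  by apply/ffunP => e; rewrite !ffunE.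
by move=> x; apply/ffunP => e; rewrite !ffunE inE; case: (x e).
Qed.

Let outcome_of_col E col : outcome_col (outcome_of (E, col)) = col.
Proof. by apply/ffunP => e; rewrite !ffunE. Qed.

Let residual_outcome_of E col : E \in graphs ->
  residual (outcome_of (E, col)) [set: 'I_n]%SET finset.set0 = E.
Proof.
rewrite graphsE inE => /andP[/fintype.subsetP sE _].
apply/setP => e; rewrite inE /usable ffunE /= inE andbT finset.subsetT andbT.
by case: (boolP (e \in E)) => // /sE; rewrite inE.
Qed.

(** All graphs with [m] edges have the same weight, so each carries an equal share of the binomial
    mass at [m]. Sets that are not pairs are absent with weight 1 and contribute only their uniform
    colour. *)
Let weight_outcome_of E col : E \in graphs ->
  \prod_e pair_weight p e (outcome_of (E, col) e) =
  binom_mass p 'C(n, 2) m * (Gnm R n m E * random_coloring R n q col).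
Proof.
move=> Eg; have := Eg; rewrite graphsE inE => /andP[sE /eqP cE].
rewrite /Gnm /random_coloring /unif -/graphs Eg inE cardsT card_ffun card_ord !mul1r.
rewrite /pair_weight; under eq_bigr do rewrite ffunE /=.
rewrite big_split /= prodr_const mulrA natrX exprVn cardT -cardE.
congr (_ * _).
transitivity (p ^+ m * (1 - p) ^+ ('C(n, 2) - m)); last first.
  have C0 : 'C('C(n, 2), m)%:R != 0 :> R by rewrite pnatr_eq0 -lt0n bin_gt0.
  rewrite /binom_mass card_graphs; move: (p ^+ m) ((1 - p) ^+ _) => a b.
  by field.
have <- : #|(pairs :\: E)%SET| = ('C(n, 2) - m)%N.
  by rewrite cardsD (finset.setIidPr sE) card_pairs cE.
rewrite -cE -!prodr_const [X in _ = X * _]big_mkcond [X in _ = _ * X]big_mkcond.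
rewrite -big_split; apply: eq_bigr => e _ /=; rewrite !inE.
case: (boolP (e \in E)) => [eE|eE]; rewrite ?mul1r ?mulr1 /=.
  by have /(fintype.subsetP sE) := eE; rewrite inE => ->.
by case: ifP.
Qed.

Let pair_weight_ge0 (e : {set 'I_n}) (l : bool * 'I_q) : 0 <= pair_weight p e l.
Proof.
rewrite /pair_weight divr_ge0 ?ler0n//; case: ifP => _; last exact: ler0n.
by case: ifP; rewrite ?subr_ge0.
Qed.

(* Conditioned on having [m] edges, the binomial random graph is uniform. *)
Lemma Gnm_transfer (h : edges -> coloring -> R) :
  (forall E col, 0 <= h E col) ->
  binom_mass p 'C(n, 2) m *
    expect (Gnm R n m) (fun E => expect (random_coloring R n q) (h E)) <=
  pmean (pair_weight p)
    (fun x => h (residual x [set: 'I_n]%SET finset.set0) (outcome_col x)).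
Proof.
move=> h0; rewrite /pmean (reindex outcome_of)/=; last exact: onW_bij outcome_of_bij.
pose F (Ec : edges * coloring) :=
  (\prod_e pair_weight p e (outcome_of Ec e)) *
  h (residual (outcome_of Ec) [set: 'I_n]%SET finset.set0) (outcome_col (outcome_of Ec)).
have F0 Ec : 0 <= F Ec by apply: mulr_ge0 => //; exact: prodr_ge0.
rewrite -[leRHS]/(\sum_Ec F Ec) (bigID (fun Ec => Ec.1 \in graphs))/=.
(* Outcomes with another number of edges are discarded, at the price of an inequality. *)
rewrite -[leLHS]addr0; apply: lerD; last by apply: sumr_ge0.
rewrite le_eqVlt; apply/orP; left; apply/eqP.
transitivity (\sum_(E in graphs) \sum_col F (E, col)); last first.
  by rewrite pair_big /=; apply: eq_big => [[E col]|[E col]]//=; rewrite andbT.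
rewrite /expect mulr_sumr [RHS]big_mkcond; apply: eq_bigr => E _.
case: ifP => Eg; last by rewrite /Gnm /unif -/graphs Eg !mul0r mulr0.
rewrite !mulr_sumr; apply: eq_bigr => col _.
by rewrite /F weight_outcome_of// residual_outcome_of// outcome_of_col; ring.
Qed.

Lemma Gnm_total : expect (Gnm R n m) (fun=> 1) = 1.
Proof.
rewrite expect_unif sumr_const divff// pnatr_eq0 -/graphs card_graphs.
by rewrite -lt0n bin_gt0.
Qed.

Lemma random_coloring_total : expect (random_coloring R n q) (fun=> 1) = 1.
Proof.
rewrite expect_unif sumr_const divff// pnatr_eq0 cardsT card_ffun card_ord.
by rewrite -lt0n expn_gt0 q_gt0.
Qed.

End transfer.

Lemma modified_greedy_ge0 (R : realType) (n q : nat)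
    (col : {ffun {set 'I_n} -> 'I_q}) k V E M M' :
  0 <= modified_greedy R col k V E M M'.
Proof.
elim: k V E M => [|k IH] V E M /=; first exact: ler0n.
case: ifP => _; first exact: ler0n.
apply: sumr_ge0 => v _; apply: mulr_ge0; first exact: unif_ge0.
case: ifP => _ //; apply: sumr_ge0 => u _.
by apply: mulr_ge0; first exact: unif_ge0.
Qed.

(** An upper bound covers the case of an empty vertex set, where [unif] has total mass 0. It makes
    the conditional failure probability nonnegative. *)
Lemma modified_greedy_le1 (R : realType) (n q : nat)
    (col : {ffun {set 'I_n} -> 'I_q}) k V E M (h : {set {set 'I_n}} -> R) :
  (forall M', h M' <= 1) -> expect (modified_greedy R col k V E M) h <= 1.
Proof.
move=> h1; have avg (T : finType) (A : {set T}) (f : T -> R) :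
    (forall t, f t <= 1) -> expect (unif R A) f <= 1.
  move=> f1; rewrite expect_unif; have [->|A0] := eqVneq A finset.set0.
    by rewrite big_set0 mul0r.
  rewrite ler_pdivrMr ?ltr0n ?card_gt0// mul1r -sumr_const.
  by apply: ler_sum.
elim: k V E M => [|k IH] V E M /=; first by rewrite expect_dret.
case: ifP => _; first by rewrite expect_dret.
rewrite expect_dbind; apply: (avg) => v; case: ifP => _ //.
by rewrite expect_dbind; apply: avg => u.
Qed.

(** * Propagation of the second moment along the chain *)

Section chain_moment.
Context (R : realType).

Lemma exprn_dist (a b : R) M : 0 <= a <= 1 -> 0 <= b <= 1 ->
  `|a ^+ M - b ^+ M| <= M%:R * `|a - b|.
Proof.
move=> /andP[a0 a1] /andP[b0 b1]; elim: M => [|M IH].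
  by rewrite !expr0 subrr normr0 mul0r.
rewrite !exprS (_ : _ - _ = (a - b) * a ^+ M + b * (a ^+ M - b ^+ M)); last by ring.
apply: le_trans (ler_normD _ _) _; rewrite !normrM -natr1 mulrDl mul1r addrC.
apply: lerD.
  apply: le_trans IH; rewrite ler_piMl//.
  by rewrite ger0_norm.
by rewrite ler_piMr// ger0_norm ?exprn_ge0// exprn_ile1.
Qed.

(** The bases satisfy [1 - th <= expR (- th) <= 1 - th + th ^+ 2], the upper bound coming from
    [expR (- th) * (1 + th) <= 1]; each of the [M] factors then contributes at most [th ^+ 2]. *)
Lemma exprn_expR_dist (th : R) M : 0 <= th <= 1 ->
  `|(1 - th) ^+ M - expR (- (th * M%:R))| <= M%:R * th ^+ 2.
Proof.
move=> /andP[t0 t1].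
have e1 : 1 - th <= expR (- th) by exact: expR_ge1Dx.
have e2 : expR (- th) * (1 + th) <= 1.
  rewrite -[leRHS](expRxMexpNx_1 th) mulrC ler_pM2r ?expR_gt0//.
  exact: expR_ge1Dx.
have e0 := expR_gt0 (- th).
have e3 : expR (- th) <= 1 - th + th ^+ 2.
  by rewrite -(ler_pM2r (x := 1 + th)); [nra|lra].
rewrite (_ : expR (- (th * M%:R)) = expR (- th) ^+ M); last first.
  by rewrite -expRM_natr mulNr.
apply: le_trans (exprn_dist _ _ _) _.
- by apply/andP; split; lra.
- by rewrite (ltW e0) expR_le1 oppr_le0.
by apply: ler_wpM2l => //; rewrite ler0_norm; lra.
Qed.

(* The [+ 1] bounds the variance of a single round. *)
Lemma chain_sqr_le n q p (z : nat -> R) (a b : R) : 1 <= a -> 0 <= b ->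
  (forall k j, (k < n)%N -> (j <= n - k.+1)%N -> 0 <= stay q p k j <= 1 /\
     (j%:R - z k + (1 - stay q p k j)) ^+ 2 <= a * (j%:R - z k.+1) ^+ 2 + b) ->
  forall k j, (k <= n)%N -> (j <= n - k)%N ->
  chain q p (fun j => (j%:R - z 0%N) ^+ 2) k j <=
    a ^+ k * ((j%:R - z k) ^+ 2 + (b + 1) * k%:R).
Proof.
move=> a1 b0 H; elim=> [|k IH] j kn jn; first by rewrite expr0 mul1r mulr0 addr0.
have [/andP[s0 s1] hs] := H k j kn jn; rewrite [leLHS]/=.
set s := stay q p k j in s0 s1 hs *.
have i1 := IH j (ltnW kn) (leq_trans jn (leq_sub2l _ (leqnSn k))).
have i2 : chain q p (fun j => (j%:R - z 0%N) ^+ 2) k j.+1 <=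
    a ^+ k * ((j.+1%:R - z k) ^+ 2 + (b + 1) * k%:R).
  by apply: IH; [exact: ltnW | lia].
have s1' : 0 <= 1 - s by rewrite subr_ge0.
apply: le_trans (lerD (ler_wpM2l s0 i1) (ler_wpM2l s1' i2)) _.
have ak : 0 <= a ^+ k by rewrite exprn_ge0// (le_trans ler01).
rewrite [a ^+ k.+1]exprSr -[leRHS]mulrA.
(* The mean square over the two outcomes of a round is the square of the mean plus the Bernoulli
   variance [s * (1 - s)]. *)
rewrite [leLHS](_ : _ = a ^+ k * ((j%:R - z k + (1 - s)) ^+ 2 + s * (1 - s) + (b + 1) * k%:R)); last first.
  by rewrite -[j.+1%:R]natr1; ring.
apply: ler_wpM2l => //.
have bk : 0 <= (b + 1) * k%:R by rewrite mulr_ge0// addr_ge0.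
have var : s * (1 - s) <= 1 by nra.
have abk : (b + 1) * k.+1%:R <= a * ((b + 1) * k.+1%:R).
  by rewrite ler_peMl// mulr_ge0// addr_ge0.
rewrite mulrDr; move: abk; rewrite -[k.+1%:R]natr1 mulrDr mulr1; lra.
Qed.

End chain_moment.

(** * Transition probabilities against the limiting drift *)

Section stay_rate.
Context (R : realType) (c kappa : R).
Hypotheses (c_gt0 : 0 < c) (kappa_gt0 : 0 < kappa).
Context (n q : nat) (p c1 : R).
Hypotheses (n_gt0 : (0 < n)%N) (p_ge0 : 0 <= p) (p_le1 : p <= 1) (c1_ge0 : 0 <= c1)
  (pn : `|p * n%:R - c| <= c1 / n%:R)
  (qn : `|q%:R - kappa * n%:R| <= 1) (q_ge : kappa * n%:R / 2 <= q%:R).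

(** The terms are the costs, in units of [1 / n], of replacing the power by an exponential, [p * n]
    by [c], [q] by [kappa * n], and [k - j] by [k.+1 - j]. *)
Definition stay_error : R := (c + c1) ^+ 2 + c1 + 2 * c / kappa ^+ 2 + c.

Let nR : 0 < n%:R :> R. Proof. by rewrite ltr0n. Qed.
Let n1 : 1 <= n%:R :> R. Proof. by rewrite ler1n. Qed.
Let qR : 0 < q%:R :> R.
Proof. by apply: lt_le_trans q_ge; rewrite divr_gt0// mulr_gt0. Qed.

Let unused_le1 j : 0 <= ((q - j)%:R / q%:R : R) <= 1.
Proof.
by rewrite divr_ge0 ?ler0n//= ler_pdivrMr// mul1r ler_nat leq_subr.
Qed.

Lemma stay_ge0_le1 k j : 0 <= stay q p k j <= 1.
Proof.
have /andP[r0 r1] := unused_le1 j.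
have h0 : 0 <= p * ((q - j)%:R / q%:R) by exact: mulr_ge0.
have h1 : p * ((q - j)%:R / q%:R) <= 1 by exact: mulr_ile1.
by rewrite exprn_ge0 ?exprn_ile1//; lra.
Qed.

(** Natural subtraction in [stay] is matched with the truncations in [rate]. *)
Lemma natr_sub_max (a b : nat) : (a - b)%:R = Num.max 0 (a%:R - b%:R) :> R.
Proof.
have [ab|ab] := leqP a b.
  by rewrite (eqP (ab : a - b == 0)%N) max_l// subr_le0 ler_nat.
by rewrite natrB ?(ltnW ab)// max_r// subr_ge0 ler_nat ltnW.
Qed.

Let max0_mul (a b : R) : 0 <= a -> a * Num.max 0 b = Num.max 0 (a * b).
Proof. by move=> a0; rewrite maxr_pMr// mulr0. Qed.

Lemma stay_rate_dist k j : (k < n)%N -> (j <= n)%N ->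
  `|1 - stay q p k j - rate c kappa (1 - k.+1%:R / n%:R) (j%:R / n%:R)|
    <= stay_error / n%:R.
Proof.
move=> kn jn; rewrite /rate.
have cg := c_gt0; have kg := kappa_gt0; have nr := nR; have n1' := n1.
have c1g := c1_ge0.
pose rho : R := (q - j)%:R / q%:R.
have /andP[r0 r1] : 0 <= rho <= 1 by exact: unused_le1.
set u := Num.max 0 (1 - _ - _); set v := Num.max 0 (kappa - _).
pose M := (k - j)%N.
have jn1 : j%:R / n%:R <= 1 :> R by rewrite ler_pdivrMr// mul1r ler_nat.
have Mn1 : 0 <= (M%:R / n%:R : R) <= 1.
  rewrite divr_ge0 ?ler0n//= ler_pdivrMr// mul1r ler_nat /M.
  by rewrite (leq_trans (leq_subr _ _))// ltnW.
have u0 : 0 <= u by rewrite le_max lexx.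
have v0 : 0 <= v by rewrite le_max lexx.
(* [u] counts the survivors before the round, [M] those other than the chosen vertex: they differ by
   at most one vertex. *)
have Mu : `|M%:R / n%:R - u| <= n%:R^-1.
  have -> : u = (k.+1 - j)%:R / n%:R.
    rewrite natr_sub_max mulrC max0_mul ?invr_ge0// /u; congr Num.max; ring.
  rewrite -mulrBl normrM (ger0_norm (x := _^-1)) ?invr_ge0// ler_piMl ?invr_ge0//.
  have [jk|kj] := leqP j k.
    by rewrite /M subSn// -natr1 opprD addrA subrr add0r normrN normr1.
  by rewrite /M (eqP (ltnW kj : k - j == 0)%N) (eqP (kj : k.+1 - j == 0)%N) subrr normr0.
have rv : `|rho - v / kappa| <= 2 / kappa ^+ 2 / n%:R.
  have -> : rho = Num.max 0 (1 - j%:R / q%:R).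
    rewrite /rho natr_sub_max mulrC max0_mul ?invr_ge0 ?ler0n// mulrBr mulVf ?gt_eqF//.
    by rewrite mulrC.
  have -> : v / kappa = Num.max 0 (1 - j%:R / n%:R / kappa).
    rewrite mulrC max0_mul ?invr_ge0 ?ltW// mulrBr mulVf ?gt_eqF//.
    by rewrite [_^-1 * _]mulrC.
  apply: le_trans (max0_lipschitz _ _) _.
  have -> : 1 - j%:R / q%:R - (1 - j%:R / n%:R / kappa) =
      (j%:R / n%:R) * ((q%:R - kappa * n%:R) / (kappa * q%:R)).
    by field; rewrite !gt_eqF.
  rewrite normrM (ger0_norm (x := j%:R / _)) ?divr_ge0//.
  apply: le_trans (ler_piMl _ jn1) _; first exact: normr_ge0.
  have kq : 0 < kappa * q%:R by rewrite mulr_gt0.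
  rewrite normrM [X in _ * X]ger0_norm; last by rewrite invr_ge0 ltW.
  apply: (@le_trans _ _ (kappa * q%:R)^-1); first by rewrite ler_piMl// invr_ge0 ltW.
  rewrite (_ : 2 / kappa ^+ 2 / n%:R = (kappa * (kappa * n%:R / 2))^-1); last first.
    by field; rewrite !gt_eqF.
  have kn2 : 0 < kappa * (kappa * n%:R / 2) by rewrite !mulr_gt0.
  by rewrite lef_pV2 ?posrE// ler_pM2l.
have vk : 0 <= v / kappa <= 1.
  rewrite divr_ge0 ?(ltW kg)//= ler_pdivrMr// mul1r /v ge_max (ltW kg)/=.
  by rewrite gerBl divr_ge0.
have ck : 0 < c / kappa by rewrite divr_gt0.
pose th := p * rho.
have th0 : 0 <= th by exact: mulr_ge0.
have th1 : th <= 1 by exact: mulr_ile1.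
have -> : 1 - stay q p k j - (1 - expR (- (c / kappa * u * v))) =
   (expR (- (c / kappa * u * v)) - expR (- (th * M%:R))) -
   ((1 - th) ^+ M - expR (- (th * M%:R))).
  by rewrite /stay -/rho -/th -/M; ring.
apply: le_trans (ler_normB _ _) _.
have th01 : 0 <= th <= 1 by rewrite th0.
have h1 := exprn_expR_dist M th01.
have thM : 0 <= th * M%:R by rewrite mulr_ge0.
have cuv : 0 <= c / kappa * u * v by apply: mulr_ge0 => //; exact: mulr_ge0 (ltW ck) u0.
have h2 := expRN_lipschitz cuv thM.
have pnle : p * n%:R <= c + c1.
  have : c1 / n%:R <= c1 by rewrite ler_pdivrMr// ler_peMr.
  have := ler_norm (p * n%:R - c); move: pn; lra.
have h3 : M%:R * th ^+ 2 <= (c + c1) ^+ 2 / n%:R.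
  have thp : th <= p by rewrite ler_piMr.
  apply: (@le_trans _ _ (n%:R * p ^+ 2)).
    apply: ler_pM => //; rewrite ?sqr_ge0//.
      by rewrite ler_nat; apply: leq_trans (leq_subr _ _) (ltnW kn).
    by rewrite lerXn2r ?nnegrE.
  rewrite ler_pdivlMr// (_ : _ * _ * _ = (p * n%:R) ^+ 2); last by ring.
  have pn0 : 0 <= p * n%:R by exact: mulr_ge0.
  have cc0 : 0 <= c + c1 by rewrite addr_ge0// ltW.
  by rewrite lerXn2r ?nnegrE.
have h4 : `|c / kappa * u * v - th * M%:R| <=
    c1 / n%:R + c * (2 / kappa ^+ 2 / n%:R) + c * n%:R^-1.
  set w := M%:R / n%:R in Mu Mn1; have /andP[w0 w1] := Mn1; have /andP[z0 z1] := vk.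
  have -> : c / kappa * u * v - th * M%:R =
     - ((p * n%:R - c) * (rho * w)) - (c * (rho - v / kappa) * w +
       c * (v / kappa) * (w - u)).
    by rewrite /th /w; field; rewrite !gt_eqF.
  apply: le_trans (ler_normB _ _) _; rewrite -addrA; apply: lerD.
    rewrite normrN normrM; apply: le_trans pn; apply: ler_piMr => //.
    rewrite ger0_norm; [exact: mulr_ile1 | exact: mulr_ge0].
  apply: le_trans (ler_normD _ _) _; apply: lerD.
    rewrite normrM (ger0_norm w0); apply: le_trans (ler_piMr _ w1) _ => //.
    by rewrite normrM (gtr0_norm cg) ler_pM2l.
  rewrite normrM; apply: ler_pM => //.
  rewrite ger0_norm; first by rewrite ler_piMr// ltW.
  exact: mulr_ge0 (ltW cg) z0.
apply: le_trans (lerD (le_trans h2 h4) (le_trans h1 h3)) _.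
by rewrite le_eqVlt; apply/orP; left; apply/eqP; rewrite /stay_error; field; rewrite !gt_eqF.
Qed.

End stay_rate.

(** * The Gronwall estimate *)

(** Young's inequality; the difference of the sides is [(u - r * v) ^+ 2 / r]. With [r = n] the
    first factor stays bounded when compounded over [n] rounds. *)
Lemma sqrD_le (R : realType) (r u v : R) : 0 < r ->
  (u + v) ^+ 2 <= (1 + r^-1) * u ^+ 2 + (1 + r) * v ^+ 2.
Proof.
move=> r0; rewrite -subr_ge0.
rewrite (_ : _ - _ = (u - r * v) ^+ 2 / r); last by field; rewrite gt_eqF.
by rewrite divr_ge0 ?sqr_ge0// ltW.
Qed.

(** One round multiplies the squared deviation by at most [(1 + 1 / n) * (1 + L / n) ^+ 2], whose
    [n]-th power is at most [expR (1 + 2 * L)], and adds at most [2 * K ^+ 2] of drift error and 1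
    of variance. *)
Definition deviation_bound (R : realType) (c kappa c1 : R) : R :=
  let L := c / kappa * (kappa + 1) in
  let K := stay_error c kappa c1 + 2 * L in
  expR (1 + 2 * L) * (2 * K ^+ 2 + 1).

Lemma chain_stopped_le (R : realType) (c kappa c1 tau0 : R) (N : R -> R)
    (n q : nat) (p : R) :
  0 < c -> 0 < kappa -> 0 <= c1 ->
  is_solution c kappa N -> 0 <= tau0 -> tau0 <= 1 -> N tau0 = 0 ->
  (0 < n)%N -> 0 <= p -> p <= 1 -> `|p * n%:R - c| <= c1 / n%:R ->
  `|q%:R - kappa * n%:R| <= 1 -> kappa * n%:R / 2 <= q%:R ->
  chain q p (fun j => (j%:R - n%:R * (1 - tau0)) ^+ 2) n 0 <=
    deviation_bound c kappa c1 * n%:R.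
Proof.
move=> c0 k0 c10 solN t0 t1 Nt n0 p0 p1 pn qn qge.
rewrite /deviation_bound; set L := c / kappa * (kappa + 1).
set K := stay_error c kappa c1 + 2 * L; rewrite -mulrA.
have nR : 0 < n%:R :> R by rewrite ltr0n.
have n1 : 1 <= n%:R :> R by rewrite ler1n.
have L0 : 0 < L by rewrite mulr_gt0 ?divr_gt0 ?addr_gt0.
pose y := stopped N tau0.
(* The predicted number of chosen edges with [k] rounds to go: 0 at [k = n] and [n * (1 - tau0)] at
   [k = 0]. *)
pose z (k : nat) : R := n%:R * y (1 - k%:R / n%:R).
have K0 : 0 <= K.
  have e0 : 0 <= stay_error c kappa c1.
    have ? : 0 < c / kappa ^+ 2 by rewrite divr_gt0// exprn_gt0.
    have := sqr_ge0 (c + c1); rewrite /stay_error -mulrA; lra.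
  by rewrite addr_ge0// mulr_ge0// ltW.
pose a := (1 + n%:R^-1) * (1 + L / n%:R) ^+ 2.
have nV : 0 < n%:R^-1 :> R by rewrite invr_gt0.
have Ln : 0 < L / n%:R by rewrite divr_gt0.
have a1 : 1 <= a.
  have h1 : 1 <= 1 + n%:R^-1 :> R by rewrite lerDl ltW.
  have h2 : 1 <= (1 + L / n%:R) ^+ 2 by rewrite exprn_ege1// lerDl ltW.
  by rewrite /a -[leLHS]mulr1; apply: ler_pM.
have step k j : (k < n)%N -> (j <= n - k.+1)%N -> 0 <= stay q p k j <= 1 /\
    (j%:R - z k + (1 - stay q p k j)) ^+ 2 <= a * (j%:R - z k.+1) ^+ 2 + 2 * K ^+ 2.
  move=> kn jn; split; first exact: (stay_ge0_le1 k0 n0 p0 p1 qge).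
  have jn' : (j <= n)%N by rewrite (leq_trans jn) ?leq_subr.
  set t : R := 1 - k.+1%:R / n%:R.
  have tk : 1 - k%:R / n%:R = t + n%:R^-1.
    by rewrite /t -[k.+1%:R]natr1; field; rewrite gt_eqF.
  have tge0 : 0 <= t by rewrite subr_ge0 ler_pdivrMr// mul1r ler_nat.
  have d1 := stay_rate_dist c0 k0 n0 p0 p1 c10 pn qn qge kn jn'; rewrite -/t in d1.
  have d2 := rate_lipschitz c0 k0 tge0 tge0 (_ : 0 <= j%:R / n%:R)
    (stopped_ge0 c0 k0 solN t0 t1 Nt tge0).
  have {}d2 := d2 (divr_ge0 (ler0n _ _) (ltW nR)).
  rewrite -/y -/L subrr normr0 add0r in d2.
  have tt : t <= t + n%:R^-1 by rewrite lerDl ltW.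
  have d3 := stopped_increment c0 k0 solN t0 t1 Nt tge0 tt.
  rewrite -/y -/L [t + _ - t]addrAC subrr add0r in d3.
  set D := j%:R - z k.+1; have DE : j%:R / n%:R - y t = D / n%:R.
    by rewrite /D /z -/t; field; rewrite gt_eqF.
  rewrite DE normrM (ger0_norm (ltW nV)) in d2.
  (* The three error sources: transition probability against drift, drift at the actual against the
     predicted state, and the Euler error of the curve. *)
  pose r := (1 - stay q p k j - rate c kappa t (j%:R / n%:R))
     + (rate c kappa t (j%:R / n%:R) - rate c kappa t (y t))
     - n%:R * (y (t + n%:R^-1) - y t - rate c kappa t (y t) * n%:R^-1).
  have -> : j%:R - z k + (1 - stay q p k j) = D + r.
    by rewrite /r /D /z tk -/t; field; rewrite gt_eqF.
  have rle : `|r| <= L / n%:R * `|D| + K / n%:R.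
    apply: le_trans (ler_normB _ _) _.
    have s1 := ler_normD (1 - stay q p k j - rate c kappa t (j%:R / n%:R))
       (rate c kappa t (j%:R / n%:R) - rate c kappa t (y t)).
    rewrite [X in _ + X]normrM (gtr0_norm nR).
    have s2 := ler_wpM2l (ltW nR) d3.
    have E2 : n%:R * (2 * L * n%:R^-1 ^+ 2) = 2 * L / n%:R :> R.
      by field; rewrite gt_eqF.
    have E3 : L * (`|D| / n%:R) = L / n%:R * `|D| by ring.
    have E4 : K / n%:R = stay_error c kappa c1 / n%:R + 2 * L / n%:R.
      by rewrite -mulrDl.
    rewrite E2 in s2; rewrite E3 in d2; rewrite E4; lra.
  have D0 := normr_ge0 D.
  have Xle : `|D + r| <= (1 + L / n%:R) * `|D| + K / n%:R.
    by apply: le_trans (ler_normD _ _) _; rewrite mulrDl mul1r; lra.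
  rewrite -[leLHS]real_normK ?num_real//.
  apply: (@le_trans _ _ (((1 + L / n%:R) * `|D| + K / n%:R) ^+ 2)).
    rewrite lerXn2r ?nnegrE// (le_trans _ Xle)//.
  apply: le_trans (sqrD_le _ _ nR) _; apply: lerD.
    by rewrite exprMn mulrA real_normK ?num_real.
  rewrite expr_div_n mulrCA mulrC; apply: ler_wpM2r; first exact: sqr_ge0.
  rewrite ler_pdivrMr ?exprn_gt0//; nra.
have zz : n%:R * (1 - tau0) = z 0%N.
  by rewrite /z mul0r subr0 /y stopped1.
rewrite zz; apply: le_trans (chain_sqr_le a1 _ step (leqnn n) _) _.
- by rewrite mulr_ge0// sqr_ge0.
- by rewrite subnn.
have -> : z n = 0 by rewrite /z divff ?gt_eqF// subrr /y (stopped0 solN)// mulr0.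
rewrite subrr expr0n add0r; apply: ler_wpM2r.
  by rewrite mulr_ge0// addr_ge0// mulr_ge0// sqr_ge0.
have ae : a <= expR ((1 + 2 * L) / n%:R).
  have -> : (1 + 2 * L) / n%:R = n%:R^-1 + (L / n%:R + L / n%:R).
    by field; rewrite gt_eqF.
  rewrite !expRD /a expr2.
  have h1 : 1 + n%:R^-1 <= expR (n%:R^-1 : R) by exact: expR_ge1Dx.
  have h2 : 1 + L / n%:R <= expR (L / n%:R) by exact: expR_ge1Dx.
  have h3 : 0 <= 1 + L / n%:R by rewrite addr_ge0// ltW.
  have h0 : 0 <= 1 + n%:R^-1 :> R by rewrite addr_ge0// ltW.
  exact: ler_pM h0 (mulr_ge0 h3 h3) h1 (ler_pM h3 h3 h2 h2).
apply: (@le_trans _ _ (expR ((1 + 2 * L) / n%:R) ^+ n)).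
  by rewrite lerXn2r ?nnegrE ?expR_ge0// (le_trans ler01).
by rewrite -expRM_natr divfK ?gt_eqF.
Qed.

(** * Failure probability in the uniform model *)

Section failure.
Context (R : realType) (n q m : nat).
Hypotheses (q_gt0 : (0 < q)%N) (m_gt0 : (0 < m)%N) (m_lt : (m < 'C(n, 2))%N).

Let p : R := m%:R / 'C(n, 2)%:R.

Let p_ge0 : 0 <= p. Proof. by rewrite divr_ge0. Qed.

Let p_le1 : p <= 1.
Proof.
by rewrite ler_pdivrMr ?mul1r ?ler_nat ?ltr0n ?(ltnW m_lt)// (leq_ltn_trans _ m_lt).
Qed.

Lemma chain_le (g1 g2 : nat -> R) :
  (forall k j, 0 <= stay q p k j <= 1) -> (forall j, g1 j <= g2 j) ->
  forall k j, chain q p g1 k j <= chain q p g2 k j.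
Proof.
move=> s01 g12; elim=> //= k IH j; have /andP[s0 s1] := s01 k j.
by apply: lerD; apply: ler_wpM2l => //; rewrite subr_ge0.
Qed.

Lemma chain_affine (g : nat -> R) (w : R) k j :
  chain q p (fun i => 1 - g i * w) k j = 1 - chain q p g k j * w.
Proof. by elim: k j => //= k IH j; rewrite !IH; ring. Qed.

(** The last factor is Chebyshev's bound in the binomial model; [2 * t.*2.+1%:R] bounds the inverse
    probability of having exactly [m] edges. *)
Lemma greedy_matching_failure (A : pred {set {set 'I_n}}) (z D : R) t :
  (forall k j, 0 <= stay q p k j <= 1) ->
  (m.*2 <= t ^ 2)%N -> 0 < D ->
  (forall M : {set {set 'I_n}}, `|#|M|%:R - z| <= D -> A M) ->
  0 <= 1 - Pr (greedy_matching R n m q) A <=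
    2 * t.*2.+1%:R * (chain q p (fun j => (j%:R - z) ^+ 2) n 0 / D ^+ 2).
Proof.
move=> s01 mt D0 HA.
have m_le := ltnW m_lt.
pose h (E : {set {set 'I_n}}) (col : {ffun {set 'I_n} -> 'I_q}) : R :=
  1 - expect (modified_greedy R col n [set: 'I_n]%SET E finset.set0) (fun M => (A M)%:R).
have h0 E col : 0 <= h E col.
  by rewrite subr_ge0; apply: modified_greedy_le1 => M; case: (A M); rewrite ?ler01.
have expect1B (T : finType) (P : law R T) (f : T -> R) : expect P (fun=> 1) = 1 ->
    expect P (fun x => 1 - f x) = 1 - expect P f.
  move=> P1; rewrite -[X in X - _]P1 /expect -sumrB.
  by apply: eq_bigr => x _; rewrite mulrBr.
have hE : 1 - Pr (greedy_matching R n m q) A =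
    expect (Gnm R n m) (fun E => expect (random_coloring R n q) (h E)).
  rewrite expect_pred /greedy_matching expect_dbind -(expect1B _ _ _ (Gnm_total R m_le)).
  apply: eq_bigr => E _; congr (_ * _); rewrite expect_dbind.
  by rewrite -(expect1B _ _ _ (random_coloring_total R n q_gt0)).
have tr := Gnm_transfer p_ge0 p_le1 m_le h0; rewrite -hE in tr.
have hge0 : 0 <= 1 - Pr (greedy_matching R n m q) A.
  rewrite hE; apply: sumr_ge0 => E _; apply: mulr_ge0; first exact: unif_ge0.
  by apply: sumr_ge0 => col _; apply: mulr_ge0; first exact: unif_ge0.
rewrite hge0 /=.
set S := chain q p _ n 0.
have hS : pmean (pair_weight p) (fun x : {ffun {set 'I_n} -> bool * 'I_q} =>
     h (residual x [set: 'I_n]%SET finset.set0) (outcome_col x)) <= S / D ^+ 2.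
  pose g j : R := (`|j%:R - z| <= D)%R%:R.
  apply: (@le_trans _ _ (pmean (pair_weight p)
      (fun x : {ffun {set 'I_n} -> bool * 'I_q} =>
         1 + greedy_mean g n x [set: 'I_n]%SET finset.set0 finset.set0 * -1))).
    apply: ler_sum => x _; apply: ler_wpM2l.
      apply: prodr_ge0 => e _; rewrite /pair_weight divr_ge0//.
      by case: ifP => _; [case: ifP => _; rewrite ?subr_ge0 | exact: ler0n].
    rewrite mulrN1 lerD2l lerN2; apply: ler_sum => M _.
    apply: ler_wpM2l; first exact: modified_greedy_ge0.
    by rewrite /g; case: (boolP (_ <= D)%R) => [/HA ->|] //; rewrite ler0n.
  have wt := pair_weight_total p q_gt0 (n := n).
  rewrite pmeanD pmean_cst// pmeanZr mulrN1.
  rewrite (pmean_greedy p g q_gt0 (j := 0)) ?cards0 ?subn0 ?cardsT ?card_ord//; last first.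
    by move=> f; rewrite inE.
  (* Chebyshev's inequality for the chain: the indicator of a small deviation dominates this
     quadratic function, and [chain] is monotone and affine in its final function. *)
  have := @chain_le (fun j => 1 - (j%:R - z) ^+ 2 * (D ^+ 2)^-1) g s01 _ n 0.
  rewrite chain_affine -/S => H.
  have {}H := H _.
  suff : 1 - S / D ^+ 2 <= chain q p g n 0 by lra.
  apply: H => j; rewrite /g; case: (leP `|j%:R - z| D) => hj.
    by rewrite gerBl mulr_ge0 ?sqr_ge0// invr_ge0 sqr_ge0.
  rewrite subr_le0 ler_pdivlMr ?exprn_gt0// mul1r -[leRHS]real_normK ?num_real//.
  by rewrite lerXn2r ?nnegrE ?(ltW D0)// ltW.
have b := binom_mode_ge R m_gt0 m_lt mt; rewrite -/p in b.
set bm := binom_mass _ _ _ in tr b.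
have tp : 0 < t.*2.+1%:R :> R by rewrite ltr0n.
have E1 := ler_wpM2r hge0 b.
have E2 := ler_wpM2l (ltW tp) (le_trans tr hS).
rewrite -mulrA; move: E1 E2; rewrite -mulrA; lra.
Qed.

End failure.

(** * Limits and conclusion *)

Lemma natr_bin2 (R : realType) n : 'C(n, 2)%:R * 2 = n%:R * (n%:R - 1) :> R.
Proof.
case: n => [|n]; first by rewrite bin0n !mul0r.
have := mul_bin_diag n.+1 1; rewrite bin1 /= => E.
rewrite -natrM mulnC -E natrM -[n.+1%:R in RHS]natr1.
by rewrite -natr1; ring.
Qed.

Lemma whp_matching_size (R : realType) (c kappa : R) (m q : nat -> nat)
    (N : R -> R) (tau0 d : R) (A : forall n, pred {set {set 'I_n}}) :
  0 < c -> 0 < kappa ->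
  (forall n : nat, `|(m n)%:R - c * n%:R / 2| < 1) ->
  (forall n : nat, `|(q n)%:R - kappa * n%:R| < 1) ->
  is_solution c kappa N -> 0 <= tau0 -> tau0 <= 1 -> N tau0 = 0 -> 0 < d ->
  (forall n (M : {set {set 'I_n}}),
     `|#|M|%:R - n%:R * (1 - tau0)| <= d * n%:R -> A n M) ->
  whp (fun n => greedy_matching R n (m n) (q n)) A.
Proof.
move=> c0 k0 mdef qdef solN t0 t1 Nt d0 HA; rewrite /whp.
(* [p * n - c = (2 * m - c * n + c) / (n - 1)], where the numerator is at most [2 + c] in absolute
   value and [n - 1 >= n / 2]. *)
pose c1 := 2 * (2 + c).
have c10 : 0 <= c1 by rewrite mulr_ge0// addr_ge0// ltW.
pose C := deviation_bound c kappa c1.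
have C0 : 0 < C.
  by rewrite mulr_gt0 ?expR_gt0// ltr_wpDl// mulr_ge0// sqr_ge0.
apply/cvgrPdist_le => e e0.
(* The window around the mode has half-width about [r * n]. This is wider than [sqrt n], but the
   factor linear in [n] meets a deviation bound [C / (d ^+ 2 * n)], and this [r] makes the leading
   term of the product equal to [e / 2]. *)
pose r := e * d ^+ 2 / (8 * C).
have d20 : 0 < d ^+ 2 by exact: exprn_gt0.
have r0 : 0 < r.
  by apply: divr_gt0; [exact: mulr_gt0 | rewrite mulr_gt0].
near=> n.
have n2 : 2 <= n%:R :> R by near: n; exact: nbhs_infty_ger.
have nc : 2 / c + 1 <= n%:R by near: n; exact: nbhs_infty_ger.
have nc3 : c + 3 <= n%:R by near: n; exact: nbhs_infty_ger.
have nk : 2 / kappa <= n%:R by near: n; exact: nbhs_infty_ger.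
have nr : 2 / r <= n%:R by near: n; exact: nbhs_infty_ger.
have nr2 : 4 * (c + 2) / r ^+ 2 <= n%:R by near: n; exact: nbhs_infty_ger.
have ne : 4 * C / (d ^+ 2 * e) <= n%:R by near: n; exact: nbhs_infty_ger.
have nR : 0 < n%:R :> R by lra.
have n_gt0 : (0 < n)%N by rewrite -(ltr0n R).
have := mdef n; rewrite ltr_norml => /andP[m1 m2].
have qn := ltW (qdef n); have := qdef n; rewrite ltr_norml => /andP[q1 q2].
have cn : 2 < c * n%:R.
  have : 2 / c < n%:R by lra.
  by rewrite ltr_pdivrMr// mulrC.
have m_gt0 : (0 < m n)%N by rewrite -(ltr0n R); lra.
have bin2E := natr_bin2 R n.
have m_lt : (m n < 'C(n, 2))%N.
  rewrite -(ltr_nat R).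
  have : (c + 3) * n%:R <= n%:R * n%:R by rewrite ler_pM2r.
  nra.
have kn : 2 <= kappa * n%:R by move: nk; rewrite ler_pdivrMr// mulrC.
have qge : kappa * n%:R / 2 <= (q n)%:R by lra.
have q_gt0 : (0 < q n)%N by rewrite -(ltr0n R); lra.
have binR : 0 < 'C(n, 2)%:R :> R by rewrite ltr0n (leq_ltn_trans _ m_lt).
set p : R := (m n)%:R / 'C(n, 2)%:R.
have p0 : 0 <= p by rewrite divr_ge0.
have p1 : p <= 1 by rewrite ler_pdivrMr// mul1r ler_nat ltnW.
have pn : `|p * n%:R - c| <= c1 / n%:R.
  have nm1 : 0 < n%:R - 1 :> R by lra.
  have pE : p * n%:R - c = (2 * (m n)%:R - c * n%:R + c) / (n%:R - 1).
    have : p * 'C(n, 2)%:R = (m n)%:R by rewrite divfK ?gt_eqF.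
    move=> pb; have {}pb : 2 * (m n)%:R = p * (n%:R * (n%:R - 1)).
      by rewrite -bin2E -pb; ring.
    by rewrite pb; field; rewrite gt_eqF.
  rewrite pE normrM (ger0_norm (x := _^-1)) ?invr_ge0 ?(ltW nm1)//.
  rewrite ler_pdivrMr// mulrAC ler_pdivlMr//.
  have h : `|2 * (m n)%:R - c * n%:R + c| <= 2 + c.
    by rewrite ler_norml; apply/andP; split; lra.
  have h2 : n%:R <= 2 * (n%:R - 1) :> R by lra.
  rewrite /c1 [2 * (2 + c)]mulrC -[leRHS]mulrA.
  by apply: ler_pM.
have s01 k j : 0 <= stay (q n) p k j <= 1.
  exact: (stay_ge0_le1 k0 n_gt0 p0 p1 qge).
pose t := Num.truncn (r * n%:R).
have rn0 : 0 <= r * n%:R by rewrite mulr_ge0// ltW.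
have /andP[tle tgt] := truncn_itv rn0; rewrite -/t in tle tgt.
have rn2 : 2 <= r * n%:R by move: nr; rewrite ler_pdivrMr// mulrC.
have mt : ((m n).*2 <= t ^ 2)%N.
  rewrite -(ler_nat R) natrX -muln2 natrM.
  have th : r * n%:R / 2 <= t%:R by move: tgt; rewrite -natr1; lra.
  have th2 : (r * n%:R / 2) ^+ 2 <= t%:R ^+ 2.
    by rewrite lerXn2r ?nnegrE// divr_ge0.
  apply: le_trans th2.
  have h : 4 * (c + 2) <= n%:R * r ^+ 2 by move: nr2; rewrite ler_pdivrMr ?exprn_gt0.
  have h2 := ler_wpM2r (ltW nR) h.
  rewrite (_ : (r * n%:R / 2) ^+ 2 = n%:R * r ^+ 2 * n%:R / 4); last by field.
  lra.
have dn : 0 < d * n%:R by rewrite mulr_gt0.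
have /andP[f0 f1] := greedy_matching_failure q_gt0 m_gt0 m_lt s01 mt dn (HA n).
rewrite ger0_norm//; apply: le_trans f1 _.
have ch := chain_stopped_le c0 k0 c10 solN t0 t1 Nt n_gt0 p0 p1 pn qn qge.
rewrite -/p; rewrite -/C in ch.
apply: (@le_trans _ _ (2 * (2 * (r * n%:R) + 1) * (C * n%:R / (d * n%:R) ^+ 2))).
  have D20 : 0 < (d * n%:R) ^+ 2 by exact: exprn_gt0.
  apply: (@le_trans _ _ (2 * t.*2.+1%:R * (C * n%:R / (d * n%:R) ^+ 2))).
    by apply: ler_wpM2l; rewrite ?mulr_ge0// ler_pM2r// invr_gt0.
  apply: ler_wpM2r; last by rewrite ler_pM2l// -natr1 -muln2 natrM; lra.
  by rewrite divr_ge0 ?(ltW D20)// mulr_ge0// ltW.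
rewrite (_ : _ * _ = e / 2 + 2 * C / (d ^+ 2 * n%:R)); last first.
  by rewrite /r; field; rewrite !gt_eqF.
have : 2 * C / (d ^+ 2 * n%:R) <= e / 2.
  rewrite ler_pdivrMr ?mulr_gt0 ?exprn_gt0//.
  move: ne; rewrite ler_pdivrMr ?mulr_gt0 ?exprn_gt0//; lra.
lra.
Unshelve. all: by end_near.
Qed.

Theorem theorem2 (R : realType) (c kappa : R) (m q : nat -> nat)
    (c_gt0 : 0 < c) (kappa_gt0 : 0 < kappa)
    (m_def : forall n : nat, `|(m n)%:R - c * n%:R / 2| < 1)
    (q_def : forall n : nat, `|(q n)%:R - kappa * n%:R| < 1) :
  ((exists (N : R -> R) (tau0 : R),
      [/\ is_solution c kappa N, 0 <= tau0 <= 1 & N tau0 = 0]) /\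
   (forall (N : R -> R) (tau0 : R),
      is_solution c kappa N -> 0 <= tau0 <= 1 -> N tau0 = 0 ->
      forall eps : R, 0 < eps ->
        whp (fun n : nat => greedy_matching R n (m n) (q n))
            (fun n M => `|#|M|%:R - (1 - tau0) * n%:R|
                          <= eps * ((1 - tau0) * n%:R)))) /\
  (1 / 2 <= kappa ->
     whp (fun n : nat => greedy_matching R n (m n) (q n))
         (fun n M => #|M|%:R <=
            (c - 1 + expR (- c)) / (2 * c - 1 + expR (- c)) * n%:R)).
Proof.
have [N solN] := solution_exists c_gt0 kappa_gt0.
have [tau0 tau01 Ntau0] := solution_has_root c_gt0 kappa_gt0 solN.
split; first split.
- by exists N, tau0.
- move=> N' tau solN' /andP[tau_ge0 tau_le1] Ntau eps eps0.
  have tau_lt1 := tau0_lt1 c_gt0 kappa_gt0 solN' tau_le1 Ntau.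
  apply: (whp_matching_size (d := eps * (1 - tau)) c_gt0 kappa_gt0 m_def q_def
    solN' tau_ge0 tau_le1 Ntau).
    by rewrite mulr_gt0// subr_gt0.
  by move=> n M; rewrite mulrA [n%:R * _]mulrC.
- move=> _; have /andP[tau_ge0 tau_le1] := tau01.
  have gt := tau0_gt c_gt0 kappa_gt0 solN tau_ge0 tau_le1 Ntau0.
  set D := 2 * c - 1 + expR (- c); rewrite -/D in gt; set b := _ / D.
  have D0 : 0 < D by have := expR_ge1Dx (- c); rewrite /D; lra.
  have bE : b = 1 - c / D by rewrite /b /D; field; rewrite gt_eqF.
  (* The allowed deviation is the whole gap between the constant in (b) and [1 - tau0], positive by
     the strict bound on the root. *)
  apply: (whp_matching_size (d := b - (1 - tau0)) c_gt0 kappa_gt0 m_def q_def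
    solN tau_ge0 tau_le1 Ntau0); first by rewrite bE; lra.
  move=> n M /ler_normlW; rewrite -/b; lra.
Qed.
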